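(* Let $\Lambda=\mathbb{Q}[t,t^{-1}]$. Let $\mathcal{A}$ be a finitely generated torsion $\Lambda$-module on which $x\mapsto(1-t)x$ is an isomorphism, and let $\phi:\mathcal{A}\times\mathcal{A}\to\mathbb{Q}(t)/\Lambda$ be a non degenerate hermitian form. Then $\mathcal{A}$ is a direct sum, orthogonal with respect to $\phi$, of submodules of the following two kinds: (i) $\frac{\Lambda}{(\pi^n)}\gamma$, where $n>0$, $\pi$ is prime and symmetric or $\pi=t+2+t^{-1}$, and $\phi(\gamma,\gamma)=\frac{P}{\pi^n}$ with $P\in\Lambda$ symmetric and prime to $\pi$; (ii) $\frac{\Lambda}{(\pi^n)}\gamma_1\oplus\frac{\Lambda}{(\overline{\pi}^n)}\gamma_2$, where either $\pi$ is prime, non symmetric, $\pi(-1)\neq0$ and $n>0$, or $\pi=1+t$ and $n>0$ is odd, and in both cases $\phi(\gamma_1,\gamma_2)=\frac{1}{\pi^n}$ and $\phi(\gamma_i,\gamma_i)=0$ for $i=1,2$.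
   Context: For $P\in\mathbb{Q}(t)$, $\overline P(t)=P(t^{-1})$. An element $P\in\Lambda$ is symmetric if $\overline P=P$; a prime element $\pi$ of $\Lambda$ is non symmetric if no multiple of $\pi$ by a unit of $\Lambda$ is symmetric. The notation $\frac{\Lambda}{(P)}\gamma$ denotes the cyclic submodule generated by $\gamma$, the annihilator of $\gamma$ being $(P)$. A form $\phi:\mathcal{A}\times\mathcal{A}\to\mathbb{Q}(t)/\Lambda$ is hermitian if it is biadditive, $\phi(P\gamma,Q\eta)=P\overline Q\,\phi(\gamma,\eta)$ for all $P,Q\in\Lambda$, and $\phi(\gamma,\eta)=\overline{\phi(\eta,\gamma)}$; it is non degenerate if $\phi(\gamma,\eta)=0$ for all $\eta$ implies $\gamma=0$. *)

(* Defs.v *)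
From HB Require Import structures.
From mathcomp Require Import all_boot all_order all_algebra.
From mathcomp Require Import boolp classical_sets.

Set Implicit Arguments.
Unset Strict Implicit.
Unset Printing Implicit Defensive.

Import GRing.Theory.
Local Open Scope ring_scope.
Local Open Scope quotient_scope.
Local Open Scope classical_set_scope.

Notation Qt := {fraction {poly rat}}.
Notation "p %:F" := (@FracField.tofrac _ p) : ring_scope.

Definition tQ : Qt := 'X%:F.

Lemma tQ_neq0 : tQ != 0.
Proof. by rewrite tofrac_eq0 polyX_eq0. Qed.

Lemma tQX_neq0 n : tQ ^+ n != 0.
Proof. by rewrite expf_neq0 // tQ_neq0. Qed.

Lemma fracE (x : Qt) : x = (\n_(repr x))%:F / (\d_(repr x))%:F.
Proof.
rewrite -[LHS]reprK; case: (repr x) => -[n d] /= d0.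
apply/eqP; rewrite -(inj_eq (mulIf (_ : d%:F != 0))) ?tofrac_eq0 //.
rewrite divfK ?tofrac_eq0 //; apply/eqP.
unlock FracField.tofrac; rewrite -[LHS]FracField.pi_mul.
apply/eqmodP; rewrite /= FracField.equivfE /FracField.mulf /=.
rewrite !numden_Ratio ?mulr1 ?oner_eq0 //.
by rewrite mulrC.
Qed.

(* The substitution of t^-1 for t, first on polynomials, then on Q(t). *)
Definition subst_inv : {poly rat} -> Qt :=
  fun p => (map_poly (@FracField.tofrac _ \o polyC) p).[tQ^-1].

Lemma subst_inv_is_zmod_morphism : zmod_morphism subst_inv.
Proof. by move=> p q; rewrite /subst_inv rmorphB hornerD hornerN. Qed.

Lemma subst_inv_is_monoid_morphism : monoid_morphism subst_inv.
Proof.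
by split=> [|p q]; rewrite /subst_inv ?rmorph1 ?hornerC ?rmorphM ?hornerM.
Qed.

HB.instance Definition _ := GRing.isZmodMorphism.Build {poly rat} Qt
  subst_inv subst_inv_is_zmod_morphism.
HB.instance Definition _ := GRing.isMonoidMorphism.Build {poly rat} Qt
  subst_inv subst_inv_is_monoid_morphism.

Lemma subst_invX : subst_inv 'X = tQ^-1.
Proof. by rewrite /subst_inv map_polyX hornerX. Qed.

Lemma subst_invC c : subst_inv c%:P = (c%:P)%:F.
Proof. by rewrite /subst_inv map_polyC hornerC. Qed.

Lemma subst_invE p : subst_inv p =
  (\poly_(i < size p) p`_((size p).-1 - i))%:F / tQ ^+ (size p).-1.
Proof.
apply/eqP; rewrite -(inj_eq (mulIf (tQX_neq0 (size p).-1))).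
rewrite divfK ?tQX_neq0 //; apply/eqP.
case: (posnP (size p)) => [/eqP|p0].
  by rewrite size_poly_eq0 => /eqP->; rewrite rmorph0 mul0r poly_def size_poly0
    big_ord0 rmorph0.
rewrite {1}/subst_inv (@horner_coef_wide _ (size p)) ?size_poly //.
rewrite poly_def rmorph_sum /= mulr_suml.
rewrite [RHS](reindex_inj rev_ord_inj) /=; apply: eq_bigr => i _.
have lei : (i <= (size p).-1)%N by rewrite -ltnS prednK.
have -> : (size p - i.+1)%N = ((size p).-1 - i)%N
  by rewrite -{1}(prednK p0) subSS.
rewrite subKn // -mul_polyC rmorphM rmorphXn coef_map /= -mulrA; congr (_ * _).
by rewrite -/tQ -{1}(subnK lei) exprD mulrCA -exprMn mulVf ?tQ_neq0 // expr1n mulr1.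
Qed.

Lemma subst_inv_eq0 p : (subst_inv p == 0) = (p == 0).
Proof.
apply/eqP/eqP => [|->]; last by rewrite rmorph0.
move/eqP; rewrite subst_invE mulf_eq0 invr_eq0 (negPf (tQX_neq0 _)) orbF.
rewrite tofrac_eq0 => /eqP p0; apply/eqP; apply: contraT => pn0.
have : (\poly_(i < size p) p`_((size p).-1 - i))`_0 = 0 by rewrite p0 coef0.
by rewrite coef_poly size_poly_gt0 pn0 subn0 => /eqP; rewrite lead_coef_eq0 (negPf pn0).
Qed.

(* P |-> P(t^-1) on Q(t); it does not depend on the chosen fraction, see
   [barQ_frac]. *)
Definition barQ (x : Qt) : Qt :=
  subst_inv \n_(repr x) / subst_inv \d_(repr x).

Lemma barQ_frac (n d : {poly rat}) : d != 0 ->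
  barQ (n%:F / d%:F) = subst_inv n / subst_inv d.
Proof.
move=> d0; rewrite /barQ; set x := n%:F / _.
have e0 : \d_(repr x) != 0 by exact: denom_ratioP.
apply/eqP; rewrite eqr_div ?subst_inv_eq0 // -!rmorphM; apply/eqP.
congr (subst_inv _); apply/eqP; rewrite -tofrac_eq !rmorphM /=.
by rewrite -eqr_div ?tofrac_eq0 // -fracE.
Qed.

Lemma barQ_is_zmod_morphism : zmod_morphism barQ.
Proof.
move=> x y; rewrite (fracE x) (fracE y).
have := denom_ratioP (repr x); have := denom_ratioP (repr y).
move: (\n_(repr x)) (\d_(repr x)) (\n_(repr y)) (\d_(repr y)) => a b c d d0 b0.
rewrite -mulNr addf_div ?tofrac_eq0 // -rmorphN -!rmorphM -rmorphD /=.
rewrite !barQ_frac ?mulf_neq0 // -mulNr addf_div ?subst_inv_eq0 //.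
by rewrite rmorphD !rmorphM rmorphN.
Qed.

Lemma barQ_tofrac p : barQ p%:F = subst_inv p.
Proof.
by rewrite -[p%:F]divr1 -(rmorph1 (@FracField.tofrac _)) barQ_frac ?oner_eq0 //
  rmorph1 divr1.
Qed.

Lemma barQ_is_monoid_morphism : monoid_morphism barQ.
Proof.
split=> [|x y].
  by rewrite -(rmorph1 (@FracField.tofrac _)) barQ_tofrac !rmorph1.
rewrite (fracE x) (fracE y).
have := denom_ratioP (repr x); have := denom_ratioP (repr y).
move: (\n_(repr x)) (\d_(repr x)) (\n_(repr y)) (\d_(repr y)) => a b c d d0 b0.
rewrite mulf_div -!rmorphM /=.
by rewrite !barQ_frac ?mulf_neq0 // mulf_div -!rmorphM.
Qed.

HB.instance Definition _ := GRing.isZmodMorphism.Build Qt Qt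
  barQ barQ_is_zmod_morphism.
HB.instance Definition _ := GRing.isMonoidMorphism.Build Qt Qt
  barQ barQ_is_monoid_morphism.

Lemma barQ_t : barQ tQ = tQ^-1.
Proof. by rewrite barQ_tofrac subst_invX. Qed.

(* Q[t, t^-1] as a subring of Q(t). *)
Definition laurent : {pred Qt} :=
  fun x => `[< exists (p : {poly rat}) (n : nat), x = p%:F / tQ ^+ n >].

Lemma laurentP (x : Qt) :
  reflect (exists (p : {poly rat}) (n : nat), x = p%:F / tQ ^+ n)
          (x \in laurent).
Proof. exact: asboolP. Qed.

Lemma laurent_subring_closed : subring_closed laurent.
Proof.
split.
- by apply/laurentP; exists 1, 0; rewrite rmorph1 divr1.
- move=> _ _ /laurentP[p [n ->]] /laurentP[q [m ->]]; apply/laurentP.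
  exists (p * 'X^m - q * 'X^n), (n + m)%N.
  rewrite -mulNr addf_div ?tQX_neq0 // -exprD.
  by rewrite rmorphB !rmorphM !rmorphXn mulNr.
- move=> _ _ /laurentP[p [n ->]] /laurentP[q [m ->]]; apply/laurentP.
  by exists (p * q), (n + m)%N; rewrite mulf_div -exprD rmorphM.
Qed.

HB.instance Definition _ :=
  GRing.isSubringClosed.Build Qt laurent laurent_subring_closed.

Record Lambda := MkLambda { lval :> Qt; lvalP : lval \in laurent }.

HB.instance Definition _ := [isSub for lval].
HB.instance Definition _ := [Choice of Lambda by <:].
HB.instance Definition _ := [SubChoice_isSubComNzRing of Lambda by <:].

Definition lunit : {pred Lambda} :=
  fun x => (lval x != 0) && ((lval x)^-1 \in laurent).
Definition linv (x : Lambda) : Lambda := if x \in lunit then insubd x (lval x)^-1 else x.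

Lemma lmulVr : {in lunit, left_inverse 1 linv *%R}.
Proof.
move=> x xu; rewrite /linv xu; case/andP: xu => x0 xV.
by apply: val_inj; rewrite rmorphM rmorph1 /= val_insubd xV mulVf.
Qed.

Lemma lunitP (x y : Lambda) : y * x = 1 -> x \in lunit.
Proof.
move=> /(congr1 lval) yx1.
have {}yx1 : lval y * lval x = 1 by [].
have x0 : lval x != 0.
  by apply: contra_eq_neq yx1 => ->; rewrite mulr0 eq_sym oner_eq0.
have -> : x \in lunit = (lval x != 0) && ((lval x)^-1 \in laurent) by [].
rewrite x0 /=; suff -> : (lval x)^-1 = lval y by apply: lvalP.
by rewrite -[RHS](mulfK x0) yx1 mul1r.
Qed.

Lemma linv_out : {in [predC lunit], linv =1 id}.
Proof. by move=> x; rewrite inE /linv => /negPf->. Qed.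

HB.instance Definition _ :=
  GRing.ComNzRing_hasMulInverse.Build Lambda lmulVr lunitP linv_out.

Lemma lmulf_eq0 (x y : Lambda) : x * y = 0 -> (x == 0) || (y == 0).
Proof.
move=> /(congr1 lval) xy0; have /eqP : lval x * lval y = 0 by [].
by rewrite mulf_eq0 -!(inj_eq val_inj).
Qed.

HB.instance Definition _ := GRing.ComUnitRing_isIntegral.Build Lambda lmulf_eq0.

Lemma tQ_laurent : tQ \in laurent.
Proof. by apply/laurentP; exists 'X, 0%N; rewrite divr1. Qed.

Lemma tQV_laurent : tQ^-1 \in laurent.
Proof. by apply/laurentP; exists 1, 1%N; rewrite rmorph1 div1r expr1. Qed.

Definition t : Lambda := MkLambda tQ_laurent.

Lemma t_unit : t \is a GRing.unit.
Proof.
apply/unitrP; exists (MkLambda tQV_laurent).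
by split; apply: val_inj; rewrite rmorphM rmorph1 /= ?mulVf ?divff ?tQ_neq0.
Qed.

Lemma barQ_laurent x : x \in laurent -> barQ x \in laurent.
Proof.
move=> /laurentP[p [n ->]].
rewrite fmorph_div rmorphXn /= barQ_t exprVn invrK barQ_tofrac subst_invE.
rewrite rpredM ?rpredX ?tQ_laurent //.
by apply/laurentP; do 2!eexists.
Qed.

Definition bar (P : Lambda) : Lambda := MkLambda (barQ_laurent (lvalP P)).

Lemma bar_is_zmod_morphism : zmod_morphism bar.
Proof. by move=> P Q; apply: val_inj; rewrite /= rmorphB. Qed.

Lemma bar_is_monoid_morphism : monoid_morphism bar.
Proof. by split=> [|P Q]; apply: val_inj; rewrite /= ?rmorph1 ?rmorphM. Qed.

HB.instance Definition _ := GRing.isZmodMorphism.Build Lambda Lambda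
  bar bar_is_zmod_morphism.
HB.instance Definition _ := GRing.isMonoidMorphism.Build Lambda Lambda
  bar bar_is_monoid_morphism.

Lemma laurent_ex (P : Lambda) :
  exists pn : {poly rat} * nat, lval P = pn.1%:F / tQ ^+ pn.2.
Proof. by case: P => /= x /laurentP[p [n ->]]; exists (p, n). Qed.

(* P(a), meaningful for a != 0 only; see [leval_frac] for the independence of
   the chosen expression of P. *)
Definition leval (P : Lambda) (a : rat) : rat :=
  let pn := projT1 (cid (laurent_ex P)) in pn.1.[a] / a ^+ pn.2.

Lemma leval_frac (P : Lambda) (a : rat) (p : {poly rat}) (n : nat) :
  a != 0 -> lval P = p%:F / tQ ^+ n -> leval P a = p.[a] / a ^+ n.
Proof.
move=> a0; rewrite /leval; case: cid => -[q m] /= -> /eqP.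
rewrite eqr_div ?tQX_neq0 // -!rmorphXn -!rmorphM tofrac_eq => /eqP.
move=> /(congr1 (horner^~ a)); rewrite /= !hornerM !hornerXn => e.
by apply/eqP; rewrite eqr_div ?expf_neq0 // e.
Qed.

(* Q(t)/Lambda as a Lambda-module. *)
Definition QtL : Type := {ideal_quot laurent}.
HB.instance Definition _ := GRing.Zmodule.on QtL.

Definition cls (x : Qt) : QtL := \pi_({ideal_quot laurent}) x.

Lemma cls_is_zmod_morphism : zmod_morphism cls.
Proof. exact: (pi_is_zmod_morphism {ideal_quot laurent}). Qed.

HB.instance Definition _ := GRing.isZmodMorphism.Build Qt QtL
  cls cls_is_zmod_morphism.

Lemma cls_eq (x y : Qt) : cls x = cls y <-> x - y \in laurent.
Proof.
rewrite /cls Quotient.idealrBE; split=> [->|/eqP //].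
by rewrite eqxx.
Qed.

Definition crepr (x : QtL) : Qt := repr (x : {ideal_quot laurent}).

Lemma creprK x : cls (crepr x) = x.
Proof. exact: reprK. Qed.

Definition cscale (P : Lambda) (x : QtL) : QtL := cls (lval P * crepr x).

Lemma cscaleE (P : Lambda) (x : Qt) : cscale P (cls x) = cls (lval P * x).
Proof.
apply/cls_eq; rewrite -mulrBr rpredM ?lvalP //.
by apply/cls_eq; rewrite creprK.
Qed.

Lemma cscaleA P Q x : cscale P (cscale Q x) = cscale (P * Q) x.
Proof. by rewrite -[x]creprK !cscaleE mulrA. Qed.

Lemma cscale1 : left_id 1 cscale.
Proof. by move=> x; rewrite -[x]creprK cscaleE mul1r. Qed.

Lemma cscaleDr : right_distributive cscale +%R.
Proof.
move=> P x y; rewrite -[x]creprK -[y]creprK -raddfD !cscaleE -raddfD.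
by rewrite mulrDr.
Qed.

Lemma cscaleDl x : {morph cscale^~ x : P Q / P + Q}.
Proof. by move=> P Q; rewrite -[x]creprK !cscaleE -raddfD -mulrDl. Qed.

HB.instance Definition _ := GRing.Zmodule_isLmodule.Build Lambda QtL
  cscaleA cscale1 cscaleDr cscaleDl.

Lemma scale_cls (P : Lambda) (x : Qt) : P *: cls x = cls (lval P * x).
Proof. exact: cscaleE. Qed.

Definition barT (x : QtL) : QtL := cls (barQ (crepr x)).

Lemma barT_cls (x : Qt) : barT (cls x) = cls (barQ x).
Proof.
apply/cls_eq; rewrite -rmorphB barQ_laurent //.
by apply/cls_eq; rewrite creprK.
Qed.

(* The class of P / Q modulo Lambda. *)
Definition cfrac (P Q : Lambda) : QtL := cls (lval P / lval Q).

Section Divisibility.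
Variable R : comUnitRingType.
Implicit Types p q d : R.

Definition divides d p : Prop := exists q, p = q * d.

Definition prime_elt p : Prop :=
  [/\ p != 0, p \isn't a GRing.unit &
      forall a b, divides p (a * b) -> divides p a \/ divides p b].

Definition prime_to p q : Prop :=
  forall d, divides d p -> divides d q -> d \is a GRing.unit.
End Divisibility.

Definition symmetric_elt (P : Lambda) : Prop := bar P = P.

Definition non_symmetric (P : Lambda) : Prop :=
  forall u : Lambda, u \is a GRing.unit -> ~ symmetric_elt (u * P).

Section Modules.
Variables (R : nzRingType) (A : lmodType R).

Definition finitely_generated : Prop :=
  exists (n : nat) (g : 'I_n -> A),
    forall x, exists c : 'I_n -> R, x = \sum_(i < n) c i *: g i.

Definition torsion : Prop :=
  forall x : A, exists2 P : R, P != 0 & P *: x = 0.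

Definition cyclic_submodule (x : A) : set A := [set P *: x | P in [set: R]].

(* Internal direct sum equal to the whole of A, for submodules M i. *)
Definition is_direct_sum (k : nat) (M : 'I_k -> set A) : Prop :=
  forall x : A, exists! f : {ffun 'I_k -> A},
    (forall i, M i (f i)) /\ x = \sum_(i < k) f i.
End Modules.

Definition annihilator_is (A : lmodType Lambda) (x : A) (P : Lambda) : Prop :=
  forall Q : Lambda, Q *: x = 0 <-> divides P Q.

Section Forms.
Variables (A : lmodType Lambda) (phi : A -> A -> QtL).

Definition hermitian_form : Prop :=
  [/\ forall x x' y, phi (x + x') y = phi x y + phi x' y,
      forall x y y', phi x (y + y') = phi x y + phi x y',
      forall (P Q : Lambda) x y,
        phi (P *: x) (Q *: y) = (P * bar Q) *: phi x y &
      forall x y, phi x y = barT (phi y x)].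

Definition non_degenerate : Prop :=
  forall x, (forall y, phi x y = 0) -> x = 0.

Definition orthogonal_family (k : nat) (M : 'I_k -> set A) : Prop :=
  forall i j, i != j -> forall x y, M i x -> M j y -> phi x y = 0.

(* t + 2 + t^-1 = t^-1 (1 + t)^2 is symmetric but not prime. *)
Definition kind_i (M : set A) : Prop :=
  exists (pi : Lambda) (n : nat) (g : A),
    [/\ (0 < n)%N,
        (prime_elt pi /\ symmetric_elt pi) \/ pi = t + 2 + t^-1,
        M = cyclic_submodule g,
        annihilator_is g (pi ^+ n) &
        exists P : Lambda,
          [/\ symmetric_elt P, prime_to P pi & phi g g = cfrac P (pi ^+ n)]].

Definition kind_ii (M : set A) : Prop :=
  exists (pi : Lambda) (n : nat) (g1 g2 : A),
    [/\ [/\ prime_elt pi, non_symmetric pi, leval pi (-1) != 0 & (0 < n)%N]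
          \/ [/\ pi = 1 + t, (0 < n)%N & odd n],
        cyclic_submodule g1 `&` cyclic_submodule g2 = [set 0]
          /\ M = [set x + y | x in cyclic_submodule g1
                            & y in cyclic_submodule g2],
        annihilator_is g1 (pi ^+ n) /\ annihilator_is g2 (bar pi ^+ n),
        phi g1 g2 = cfrac 1 (pi ^+ n) &
        phi g1 g1 = 0 /\ phi g2 g2 = 0].
End Forms.

(* Main.v *)
(* Choose a maximal family of pairwise orthogonal nonzero submodules of the two
   kinds; it is finite because A has finite dimension over Q.  Each member is
   non degenerate and complemented by its orthogonal, so the orthogonal B of the
   family is a non degenerate complement of its sum, and it suffices to find a
   submodule of one of the two kinds in B when B <> 0.

   Let pi be a prime killing a nonzero element of B and let x in B have maximal
   exponent: pi^n x = 0 and pi^(n-1) x <> 0.  Non degeneracy gives y in B killed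
   by a power of bar pi with phi(x, y) = 1 / pi^n.
   - If pi does not divide bar pi, maximality gives bar pi^n y = 0, and
     phi(x, x) = phi(y, y) = 0 because pi^n and bar pi^n are coprime.
   - If pi divides bar pi, then up to a unit pi is symmetric, or 1 + t, or 1 - t;
     the last one is excluded because 1 - t acts injectively.
   - If a unit multiple q of pi^n is symmetric (pi symmetric, or pi = 1 + t and n
     even), one of x, y, x + y has a self-pairing P / q with P prime to pi.
   - If pi = 1 + t and n is odd, then bar q = t^-n q for q = pi^n forces pi to
     divide the numerator of phi(x, x), and a Hensel iteration replaces x, then
     y, by isotropic elements. *)
Require Import Defs.
From HB Require Import structures.
From mathcomp Require Import all_boot all_order all_algebra.
From mathcomp Require Import ring boolp classical_sets.
Import GRing.Theory.
Local Open Scope ring_scope.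

Set Implicit Arguments.
Unset Strict Implicit.
Unset Printing Implicit Defensive.

(** * Divisibility, Bezout relations and nilpotency in commutative rings *)

Section CommutativeRings.
Variable R : comUnitRingType.
Implicit Types p q d : R.

Lemma divides_refl p : divides p p.
Proof. by exists 1; rewrite mul1r. Qed.

Lemma divides_trans q p d : divides p q -> divides q d -> divides p d.
Proof. by move=> [a ->] [b ->]; exists (b * a); rewrite mulrA. Qed.

Lemma divides_mull p q d : divides d q -> divides d (p * q).
Proof. by move=> [a ->]; exists (p * a); rewrite mulrA. Qed.

Lemma divides_mulr p q d : divides d p -> divides d (p * q).
Proof. by rewrite mulrC; apply: divides_mull. Qed.

Lemma dividesD p q d : divides d p -> divides d q -> divides d (p + q).
Proof. by move=> [a ->] [b ->]; exists (a + b); rewrite mulrDl. Qed.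

Lemma dividesN p d : divides d p -> divides d (- p).
Proof. by move=> [a ->]; exists (- a); rewrite mulNr. Qed.

Lemma dividesB p q d : divides d p -> divides d q -> divides d (p - q).
Proof. by move=> dp dq; apply: dividesD => //; apply: dividesN. Qed.

Lemma divides0 d : divides d 0.
Proof. by exists 0; rewrite mul0r. Qed.

Lemma divides_exp p m n : (m <= n)%N -> divides (p ^+ m) (p ^+ n).
Proof. by move=> mn; exists (p ^+ (n - m)); rewrite -exprD subnK. Qed.

Lemma divides_unit p d u : u \is a GRing.unit -> divides d (u * p) -> divides d p.
Proof.
by move=> uU [q e]; exists (u^-1 * q); rewrite -mulrA -e mulrA mulVr ?mul1r.
Qed.

Lemma prime_ndivides_exp p q n : prime_elt p -> (0 < n)%N ->
  ~ divides p q -> ~ divides p (q ^+ n).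
Proof.
move=> [p0 pU pP] + npq; case: n => // n _; elim: n => [|n IHn]; first by rewrite expr1.
by rewrite exprS => /pP[].
Qed.

(** Induction on [n]: the summand [v * p] of the given relation is multiplied by the relation
    already found for [p ^+ n]. *)
Lemma bezoutXn p q n : (exists u v, u * q + v * p = 1) ->
  exists u v, u * q + v * p ^+ n = 1.
Proof.
move=> [u [v e]]; elim: n => [|n [u' [v' e']]].
  by exists 0, 1; rewrite expr0 mul0r add0r mulr1.
exists (u + v * p * u'), (v * v'); rewrite -[RHS]e -[v * p in RHS]mulr1 -e'.
by rewrite exprS mulrDr mulrDl !mulrA addrA [v * v' * p]mulrAC.
Qed.

(** The first equation says that [- (a * b)] fixes [v]; so does its [k]-th power, which is a
    multiple of [a ^+ k] and kills [v]. *)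
Lemma nilpotent_cancel (V : lmodType R) (a b : R) (v : V) k :
  (1 + a * b) *: v = 0 -> a ^+ k *: v = 0 -> v = 0.
Proof.
rewrite scalerDl scale1r => /eqP; rewrite addr_eq0 => /eqP e.
have {}e : v = (- (a * b)) *: v by rewrite scaleNr -e.
have it m : v = (- (a * b)) ^+ m *: v.
  by elim: m => [|m IHm]; rewrite ?expr0 ?scale1r // exprSr -scalerA -e.
move=> ak; rewrite (it k) -mulrN exprMn mulrC -scalerA ak scaler0 //.
Qed.

End CommutativeRings.

(** * Units and primes in integral domains *)

Section IntegralDomains.
Variable R : idomainType.
Implicit Types u p q : R.

Lemma prime_neq0 p : prime_elt p -> p <> 0.
Proof. by case=> /eqP. Qed.

Lemma exp_neq0 p n : p <> 0 -> p ^+ n <> 0.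
Proof. by move=> /eqP p0; apply/eqP; rewrite expf_neq0. Qed.

Lemma unit_neq0 u : u \is a GRing.unit -> u <> 0.
Proof. by move=> uU u0; rewrite u0 unitr0 in uU. Qed.

Lemma mul_neq0 p q : p <> 0 -> q <> 0 -> p * q <> 0.
Proof. by move=> /eqP p0 /eqP q0; apply/eqP; rewrite mulf_neq0. Qed.

Lemma prime_unitM u p : u \is a GRing.unit -> prime_elt p -> prime_elt (u * p).
Proof.
move=> uU [p0 pU pP]; split.
- by rewrite mulf_neq0 //; apply: contraTneq uU => ->; rewrite unitr0.
- by rewrite unitrM uU.
have up d : divides p d -> divides (u * p) d.
  by move=> [a ->]; exists (a * u^-1); rewrite -!mulrA mulKr.
move=> a b [d e]; have /pP[] : divides p (a * b).
- by exists (d * u); rewrite -mulrA.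
- by left; apply: up.
- by right; apply: up.
Qed.

(** Writing [p = a * q], primality makes [p] divide [a] or [q], and the former would make [q] a
    unit. *)
Lemma prime_associate p q : prime_elt p -> q \isn't a GRing.unit -> divides q p ->
  divides p q.
Proof.
move=> [p0 _ pP] /negP qU [a pE]; have [] := pP a q; rewrite -?pE //.
  by exists 1; rewrite mul1r.
move=> [b aE]; case: qU; apply/unitrPr; exists b.
by apply: (mulIf p0); rewrite mul1r {2}pE aE; ring.
Qed.

End IntegralDomains.

(** * Laurent polynomials as polynomials up to powers of t: principal ideals and remainders *)

Lemma laurent_tofrac (p : {poly rat}) : p%:F \in laurent.
Proof. by apply/laurentP; exists p, 0; rewrite expr0 divr1. Qed.

Definition polyL (p : {poly rat}) : Lambda := MkLambda (laurent_tofrac p).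

Lemma polyL_is_zmod_morphism : zmod_morphism polyL.
Proof. by move=> p q; apply: val_inj; rewrite /= rmorphB. Qed.

Lemma polyL_is_monoid_morphism : monoid_morphism polyL.
Proof. by split=> [|p q]; apply: val_inj; rewrite /= ?rmorph1 ?rmorphM. Qed.

HB.instance Definition _ := GRing.isZmodMorphism.Build {poly rat} Lambda
  polyL polyL_is_zmod_morphism.
HB.instance Definition _ := GRing.isMonoidMorphism.Build {poly rat} Lambda
  polyL polyL_is_monoid_morphism.

Lemma lvalM P Q : lval (P * Q) = lval P * lval Q. Proof. by []. Qed.
Lemma lvalXn P n : lval (P ^+ n) = lval P ^+ n.
Proof. by elim: n => // n IHn; rewrite exprS [RHS]exprS -IHn. Qed.

Lemma lval_eq0 P : (lval P == 0) = (P == 0).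
Proof. by rewrite -(inj_eq val_inj). Qed.

Lemma polyL_eq0 p : (polyL p == 0) = (p == 0).
Proof. by rewrite -lval_eq0 tofrac_eq0. Qed.

Lemma polyL_inj : injective polyL.
Proof. by move=> p q /(congr1 lval)/eqP; rewrite tofrac_eq => /eqP. Qed.

Lemma polyLX : polyL 'X = t.
Proof. exact: val_inj. Qed.

Lemma lval_inj : injective lval.
Proof. exact: val_inj. Qed.

Lemma polyL_repr (P : Lambda) : exists p n, t ^+ n * P = polyL p.
Proof.
have [[p n] /= e] := laurent_ex P; exists p, n; apply: lval_inj.
by rewrite lvalM lvalXn /= e mulrC divfK ?tQX_neq0.
Qed.

Definition ratL (c : rat) : Lambda := polyL c%:P.

HB.instance Definition _ := GRing.RMorphism.copy ratL (polyL \o polyC).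

Lemma ratL_unit c : c != 0 -> ratL c \is a GRing.unit.
Proof. by move=> c0; rewrite rmorph_unit // poly_unitE size_polyC c0 coefC /= unitfE. Qed.

Lemma tX_unit n : t ^+ n \is a GRing.unit.
Proof. exact: (unitrX n t_unit). Qed.

Lemma tX_neq0 n : t ^+ n <> 0.
Proof. exact: (unit_neq0 (tX_unit n)). Qed.

(** Powers of the unit [t] bring elements of the ideal into Q[t], where one of minimal size
    generates by Euclidean division. Its constant term is nonzero, since otherwise division by [t]
    would give a smaller one. *)
Lemma Lambda_principal (I : Lambda -> Prop) :
    (forall P Q, I P -> I Q -> I (P + Q)) -> (forall P Q, I Q -> I (P * Q)) ->
    (exists2 P, P <> 0 & I P) ->
  exists p : {poly rat}, [/\ p != 0, p`_0 != 0, I (polyL p) &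
    forall Q, I Q -> divides (polyL p) Q].
Proof.
move=> ID IM [P0 P0n0 IP0].
have ex : exists n, `[< exists p : {poly rat}, [/\ p != 0, I (polyL p) & size p = n] >].
  have [p [n e]] := polyL_repr P0.
  exists (size p); apply/asboolP; exists p; split=> //; last by rewrite -e; apply: IM.
  by apply/eqP => p0; case: (mul_neq0 (@tX_neq0 n) P0n0); rewrite e p0 rmorph0.
case: (ex_minnP ex) => n /asboolP[p [pn0 Ip <-]] pmin.
have {}pmin q : q != 0 -> I (polyL q) -> (size p <= size q)%N.
  by move=> qn0 Iq; apply: pmin; apply/asboolP; exists q.
exists p; split=> //.
  apply/eqP => p00; have /factor_theorem [q e] : root p 0.
    by rewrite rootE horner_coef0 p00.
  move: e; rewrite subr0 => e; have qn0 : q != 0.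
    by apply: contra_neq pn0 => q0; rewrite e q0 mul0r.
  have Iq : I (polyL q).
    have -> : polyL q = t^-1 * polyL p by rewrite e rmorphM /= polyLX mulrC mulrK ?t_unit.
    exact: IM.
  by have := pmin _ qn0 Iq; rewrite e size_mulX // ltnn.
move=> Q IQ; have [q [m e]] := polyL_repr Q.
apply: (divides_unit (tX_unit m)); rewrite e.
have [r0|r0] := eqVneq (q %% p) 0.
  by exists (polyL (q %/ p)); rewrite {1}(divp_eq q p) r0 addr0 rmorphM.
suff Ir : I (polyL (q %% p)).
  by have := pmin _ r0 Ir; rewrite leqNgt ltn_modp pn0.
have -> : q %% p = q - q %/ p * p by rewrite {2}(divp_eq q p) addrC addKr.
rewrite rmorphB rmorphM -mulNr /=.
by apply: ID; [rewrite -e|]; apply: IM.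
Qed.

(** A generator [d] of the ideal (p, q) divides the prime [p], so it is a unit or a multiple of [p];
    in the latter case [p] would divide [q]. *)
Lemma prime_bezout (p q : Lambda) : prime_elt p -> ~ divides p q ->
  exists u v, u * q + v * p = 1.
Proof.
move=> [p0 pU pP] npq.
have [] := @Lambda_principal (fun d => exists u v, u * q + v * p = d).
- by move=> _ _ [u [v <-]] [u' [v' <-]]; exists (u + u'), (v + v');
    rewrite !mulrDl addrACA.
- by move=> a _ [u [v <-]]; exists (a * u), (a * v); rewrite mulrDr !mulrA.
- by exists p; [exact/eqP|]; exists 0, 1; rewrite mul0r mul1r add0r.
move=> d0 [_ _]; move: (polyL d0) => d [u [v e]] dP.
have [a pE] : divides d p by apply: dP; exists 0, 1; rewrite mul0r mul1r add0r.
have dq : divides d q by apply: dP; exists 1, 0; rewrite mul0r mul1r addr0.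
have [] := pP a d; first by rewrite -pE; apply: divides_refl.
  move=> [b aE]; have dU : d \is a GRing.unit.
    apply/unitrP; exists b; suff bd : b * d = 1 by split; rewrite // mulrC.
    apply: (mulIf p0); rewrite mul1r {2}pE aE.
    by rewrite -!mulrA [d * p]mulrC.
  exists (d^-1 * u), (d^-1 * v); rewrite -!mulrA -mulrDr e mulVr //.
by move=> pd; case: npq; apply: divides_trans pd dq.
Qed.

Lemma polyL_remainder (p : {poly rat}) Q : p`_0 != 0 ->
  exists2 r : {poly rat}, (size r < size p)%N & divides (polyL p) (Q - polyL r).
Proof.
move=> p0; have pn0 : p != 0 by apply: contra_neq p0 => ->; rewrite coef0.
have [q [n e]] := polyL_repr Q.
(* As [p] has a nonzero constant term, it is prime to powers of X, and [u] represents t^-n modulo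
   [p]. So [u * q] represents [Q], and its remainder is the witness. *)
have /Bezout_eq1_coprimepP [[u v] /= uv] : coprimep ('X ^+ n) p.
  rewrite coprimep_sym coprimep_expr // -['X]subr0 coprimep_XsubC.
  by rewrite rootE horner_coef0.
exists ((u * q) %% p); first by rewrite ltn_modp.
apply: (divides_unit (tX_unit n)).
rewrite mulrBr e -polyLX -rmorphXn -rmorphM -rmorphB /=.
exists (polyL (v * q + 'X ^+ n * ((u * q) %/ p))); rewrite -rmorphM /=.
congr polyL; have -> : (u * q) %% p = u * q - (u * q) %/ p * p.
  by rewrite {2}(divp_eq (u * q) p) addrC addKr.
by rewrite -[X in X - _]mul1r -uv; ring.
Qed.


(** * The involution [bar] *)

Lemma barQK : involutive barQ.
Proof.
have polyK (p : {poly rat}) : barQ (subst_inv p) = p%:F.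
  elim/poly_ind: p => [|p c IHp]; first by rewrite !rmorph0.
  rewrite !rmorphD !rmorphM /= subst_invX subst_invC fmorphV /= barQ_t invrK.
  by rewrite barQ_tofrac subst_invC IHp.
move=> x; rewrite [x in LHS]fracE barQ_frac; last exact: denom_ratioP.
by rewrite fmorph_div /= !polyK -fracE.
Qed.

Lemma barK : involutive bar.
Proof. by move=> P; apply: lval_inj; rewrite /= barQK. Qed.

Lemma bar_eq0 P : bar P = 0 <-> P = 0.
Proof. by split=> [/(congr1 bar)|->]; rewrite ?barK rmorph0. Qed.

Lemma bar_unit P : P \is a GRing.unit -> bar P \is a GRing.unit.
Proof. exact: rmorph_unit. Qed.

Lemma bar_t : bar t = t^-1.
Proof.
apply: (mulrI t_unit); rewrite divrr ?t_unit //; apply: lval_inj.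
by rewrite lvalM /= barQ_t divff ?tQ_neq0.
Qed.

Lemma bar_ratL c : bar (ratL c) = ratL c.
Proof. by apply: lval_inj; rewrite /= barQ_tofrac subst_invC. Qed.

Lemma divides_bar P Q : divides P Q -> divides (bar P) (bar Q).
Proof. by move=> [a ->]; exists (bar a); rewrite rmorphM. Qed.

(** * Classes of fractions in Q(t)/Lambda *)

Section Fractions.
Implicit Types (P Q a : Lambda).

Lemma cfrac_eq0 P Q : Q <> 0 -> cfrac P Q = 0 <-> divides Q P.
Proof.
move=> Q0; have lQ0 : lval Q != 0 by rewrite lval_eq0; apply/eqP.
rewrite /cfrac -(raddf0 cls); split=> [/cls_eq|[a ->]].
  rewrite subr0 => PQ; exists (MkLambda PQ); apply: lval_inj.
  by rewrite lvalM /= divfK.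
by apply/cls_eq; rewrite subr0 lvalM mulfK // lvalP.
Qed.

Lemma cfracD P P' Q : cfrac (P + P') Q = cfrac P Q + cfrac P' Q.
Proof. by rewrite /cfrac -raddfD -mulrDl. Qed.

Lemma cfrac_addM a P Q : Q <> 0 -> cfrac (P + a * Q) Q = cfrac P Q.
Proof.
move=> Q0; rewrite cfracD; have -> : cfrac (a * Q) Q = 0; last exact: addr0.
by apply/(cfrac_eq0 _ Q0); exists a.
Qed.

Lemma scale_cfrac a P Q : a *: cfrac P Q = cfrac (a * P) Q.
Proof. by rewrite /cfrac scale_cls mulrA. Qed.

Lemma cfracE P Q : cfrac P Q = P *: cfrac 1 Q.
Proof. by rewrite scale_cfrac mulr1. Qed.

Lemma cfracMM a P Q : a <> 0 -> cfrac (a * P) (a * Q) = cfrac P Q.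
Proof.
by move=> /eqP; rewrite -lval_eq0 /cfrac !lvalM invfM mulrACA => a0; rewrite divff ?mul1r.
Qed.

Lemma barT_cfrac P Q : barT (cfrac P Q) = cfrac (bar P) (bar Q).
Proof. by rewrite barT_cls fmorph_div. Qed.

Lemma cfrac_ex Q (c : QtL) : Q <> 0 -> Q *: c = 0 -> exists P, c = cfrac P Q.
Proof.
move=> /eqP; rewrite -lval_eq0 => Q0; rewrite -[c]creprK scale_cls.
rewrite -(raddf0 cls) => /cls_eq; rewrite subr0 => PQ.
by exists (MkLambda PQ); rewrite /cfrac /= mulrC mulKf.
Qed.

Lemma barTZ P (c : QtL) : barT (P *: c) = bar P *: barT c.
Proof. by rewrite -[c]creprK scale_cls !barT_cls scale_cls rmorphM. Qed.

Lemma barT0 : barT 0 = 0.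
Proof. by rewrite -[in LHS](raddf0 cls) barT_cls !raddf0. Qed.

End Fractions.

(** * Evaluation at e = 1 or -1, expressed by divisibility by t - e *)

Section SignRoots.
Variable e : rat.
Implicit Types P : Lambda.
Hypothesis e2 : e ^+ 2 = 1.

Let e0 : e != 0.
Proof. by apply: contra_eq_neq e2 => ->; rewrite expr0n eq_sym oner_eq0. Qed.

(** Division by the linear polynomial leaves a constant remainder; [r] plays the role of the value
    P(e). *)
Lemma linear_rat P : exists r : rat, divides (t - ratL e) (P - ratL r).
Proof.
have [|r szr] := @polyL_remainder ('X - e%:P) P.
  by rewrite coefB coefX coefC sub0r oppr_eq0.
move: szr; rewrite size_XsubC ltnS => /size1_polyC ->.
by rewrite rmorphB /= polyLX; exists r`_0.
Qed.

Lemma linear_divides_ratL r : divides (t - ratL e) (ratL r) -> r = 0.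
Proof.
move=> [Q rE]; have [q [n qE]] := polyL_repr Q.
have {qE}rE : polyL ('X ^+ n * r%:P) = polyL (q * ('X - e%:P)).
  by rewrite !rmorphM /= rmorphXn /= polyLX -qE rmorphB /= polyLX -mulrA -rE.
move/polyL_inj/(congr1 (horner^~ e)): rE => /eqP.
rewrite /= !hornerM hornerXn hornerXsubC hornerC subrr mulr0 mulf_eq0.
by rewrite expf_eq0 (negPf e0) andbF => /eqP.
Qed.

Lemma bar_linear : bar (t - ratL e) = - ratL e * t^-1 * (t - ratL e).
Proof.
rewrite rmorphB /= bar_t bar_ratL mulrBr mulrVK ?t_unit //.
by rewrite !mulNr opprK mulrAC -rmorphM -expr2 e2 rmorph1 mul1r addrC.
Qed.

(** As e is its own inverse, [t - ratL e] is associate to its conjugate, and P and its conjugate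
    take the same value at e. *)
Lemma linear_divides_bar P r : divides (t - ratL e) (P - ratL r) ->
  divides (t - ratL e) (bar P - ratL r).
Proof.
move/divides_bar; rewrite [bar (P - _)]rmorphB /= bar_ratL => ePr.
apply: divides_trans ePr.
by exists (- ratL e * t^-1); rewrite bar_linear.
Qed.

(** Values at [e] are multiplicative, and a constant divisible by [t - ratL e] is zero. *)
Lemma linear_prime : prime_elt (t - ratL e).
Proof.
have nU : t - ratL e \isn't a GRing.unit.
  apply/negP => eU; have : divides (t - ratL e) (ratL 1).
    by exists (ratL 1 * (t - ratL e)^-1); rewrite mulrVK.
  by move/linear_divides_ratL/eqP; rewrite oner_eq0.
split=> // [|a b].
  by rewrite -polyLX -rmorphB /= polyL_eq0 polyXsubC_eq0.
have [r ar] := linear_rat a; have [s bs] := linear_rat b => ab.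
have : divides (t - ratL e) (ratL (r * s)).
  have -> : ratL (r * s) = a * b - a * (b - ratL s) - (a - ratL r) * ratL s.
    rewrite rmorphM /=.
    by rewrite mulrBr mulrBl opprB addrCA subrr addr0 opprB addrCA subrr addr0.
  by apply: dividesB; [apply: dividesB; [|apply: divides_mull]|apply: divides_mulr].
move/linear_divides_ratL/eqP; rewrite mulf_eq0 => /orP[]/eqP z.
  by left; move: ar; rewrite z rmorph0 subr0.
by right; move: bs; rewrite z rmorph0 subr0.
Qed.

End SignRoots.


(** * Elements dividing their conjugate, and the special elements 1 + t and t + 2 + t^-1 *)

Lemma linear_divides_exp (e : rat) n : divides (t - ratL e) (t ^+ n - ratL (e ^+ n)).
Proof. by rewrite rmorphXn /= subrXX mulrC; eexists; reflexivity. Qed.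

(** The right-hand side is the reciprocal polynomial of [p]. *)
Lemma bar_polyL (p : {poly rat}) : t ^+ (size p).-1 * bar (polyL p) =
  polyL (\poly_(i < size p) p`_((size p).-1 - i)).
Proof.
apply: lval_inj; rewrite lvalM lvalXn /= barQ_tofrac subst_invE mulrC.
by rewrite divfK ?tQX_neq0.
Qed.

(** Divisibility in Lambda is divisibility of some ['X ^+ n * q] in Q[t]; the power of X is prime to
    [p] and can be removed. *)
Lemma polyL_divides (p q : {poly rat}) : p`_0 != 0 ->
  divides (polyL p) (polyL q) -> p %| q.
Proof.
move=> p0 [Q qE]; have [r [n rE]] := polyL_repr Q.
have /polyL_inj e : polyL ('X ^+ n * q) = polyL (r * p).
  by rewrite !rmorphM /= rmorphXn /= polyLX -rE -mulrA qE.
have cop : coprimep p ('X ^+ n).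
  by rewrite coprimep_expr // -['X]subr0 coprimep_XsubC rootE horner_coef0.
by rewrite -(Gauss_dvdpr _ cop) e dvdp_mull.
Qed.

(** Comparing sizes, the quotient of the reciprocal polynomial by [p] is a constant [c]. It sends
    the constant coefficient of [p] to the leading one and conversely, so its square is 1. *)
Lemma bar_self_associate (p : {poly rat}) : p`_0 != 0 ->
    divides (polyL p) (bar (polyL p)) ->
  exists2 c : rat, c ^+ 2 = 1 & t ^+ (size p).-1 * bar (polyL p) = ratL c * polyL p.
Proof.
move=> p0 /(divides_mull (t ^+ (size p).-1)).
have pn0 : p != 0 by apply: contra_neq p0 => ->; rewrite coef0.
have d_lt : ((size p).-1 < size p)%N by rewrite prednK // size_poly_gt0.
rewrite bar_polyL; set r := \poly_(i < _) _ => /(polyL_divides p0)/dvdpP[q rE].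
have r0E : r`_0 = lead_coef p by rewrite coef_poly size_poly_gt0 pn0 subn0.
have rdE : r`_(size p).-1 = p`_0 by rewrite coef_poly d_lt subnn.
have qn0 : q != 0.
  by apply: contraNneq pn0 => q0; rewrite -lead_coef_eq0 -r0E rE q0 mul0r coef0.
have /size1_polyC qE : (size q <= 1)%N.
  have : (size r <= size p)%N by apply: size_poly.
  by rewrite rE size_mul // -subn1 leq_subLR leq_add2r.
exists q`_0; last by rewrite rE rmorphM /= {1}qE.
move: r0E rdE; rewrite rE qE !coefCM coefC /= => e1 e2.
by apply: (mulIf p0); rewrite mul1r expr2 -mulrA e1.
Qed.

(** Let d be the degree of [p] and c the sign from [bar_self_associate]. If c = 1 and d is even,
    t^(-d/2) makes [p] symmetric. Otherwise some sign e satisfies e^d = -c: e = -1 if c = 1, and e =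
    1 if c = -1. *)
Lemma self_associate_cases (p : {poly rat}) : p`_0 != 0 ->
    divides (polyL p) (bar (polyL p)) ->
  (exists2 u : Lambda, u \is a GRing.unit & symmetric_elt (u * polyL p)) \/
  (exists2 e : rat, e = 1 \/ e = -1 & divides (t - ratL e) (polyL p)).
Proof.
move=> p0 pd; have [c c2 pE] := bar_self_associate p0 pd.
move: (polyL p) (size p).-1 pE => P d PE {p p0 pd}.
(* Evaluating t^d bar P = c P at [e], with r = P(e), gives e^d r = c r; as e^d = -c, this forces 2 c
   r = 0. *)
have root_case (e : rat) : e = 1 \/ e = -1 -> e ^+ d = - c ->
    divides (t - ratL e) P.
  move=> e1 ed; have e2 : e ^+ 2 = 1 by case: e1 => ->; rewrite ?expr1n ?sqrrN ?expr1n.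
  have [r Pr] := linear_rat e2 P; have Pbr := linear_divides_bar e2 Pr.
  suff r0 : r = 0 by move: Pr; rewrite r0 rmorph0 subr0.
  suff : divides (t - ratL e) (ratL (2 * c * r)).
    move/(linear_divides_ratL e2)/eqP; rewrite !mulf_eq0 /=.
    have /negPf-> : c != 0 by apply: contra_eq_neq c2 => ->; rewrite expr0n.
    by move/eqP.
  have tE := linear_divides_exp e d; rewrite ed in tE.
  have -> : ratL (2 * c * r) = (t ^+ d - ratL (- c)) * bar P
      - ratL c * (P - ratL r) - ratL c * (bar P - ratL r).
    by rewrite mulrBl PE rmorphN !rmorphM /= rmorph_nat; ring.
  apply: dividesB; last exact: divides_mull.
  by apply: dividesB; [apply: divides_mulr|apply: divides_mull].
have /orP[] : (c == 1) || (c == -1) by rewrite -sqrf_eq1; apply/eqP.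
  move/eqP=> c1; case: (boolP (odd d)) => od.
    by right; exists (-1); [right|apply: root_case; [right|rewrite -signr_odd od c1]].
  left; exists (t^-1 ^+ d./2); first by rewrite unitrX // unitrV t_unit.
  rewrite /symmetric_elt rmorphM rmorphXn /= -bar_t barK.
  apply: (mulrI (tX_unit d./2)); rewrite mulrA -exprD addnn even_halfK // PE c1.
  by rewrite rmorph1 mul1r bar_t mulrA -exprMn divrr ?t_unit // expr1n mul1r.
move/eqP=> c1; right; exists 1; first by left.
by apply: root_case; [left|rewrite c1 expr1n opprK].
Qed.

Lemma leval_eq0_divides (P : Lambda) (a : rat) : a != 0 -> leval P a = 0 ->
  divides (t - ratL a) P.
Proof.
move=> a0; have [[p n] /= PE] := laurent_ex P; rewrite (leval_frac a0 PE).
move/eqP; rewrite mulf_eq0 invr_eq0 expf_eq0 (negPf a0) andbF orbF.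
move=> /factor_theorem[q pE]; apply: (divides_unit (tX_unit n)).
exists (polyL q); rewrite -polyLX -rmorphB -rmorphM /= -pE; apply: lval_inj.
by rewrite lvalM lvalXn /= PE mulrC divfK ?tQX_neq0.
Qed.

Lemma onePt : 1 + t = t - ratL (-1).
Proof. by rewrite rmorphN rmorph1 opprK addrC. Qed.

Lemma onePt_prime : prime_elt (1 + t).
Proof. by rewrite onePt; apply: linear_prime; rewrite sqrrN expr1n. Qed.

Lemma bar_onePt : bar (1 + t) = t^-1 * (1 + t).
Proof. by rewrite rmorphD rmorph1 /= bar_t mulrDr mulr1 mulVr ?t_unit // addrC. Qed.

Lemma sigma_onePt : t + 2 + t^-1 = t^-1 * (1 + t) ^+ 2.
Proof.
have -> : t^-1 * (1 + t) ^+ 2 = t^-1 + 2 * (t^-1 * t) + t^-1 * t * t by ring.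
by rewrite mulVr ?t_unit // mulr1 mul1r [RHS]addrC [t^-1 + 2]addrC addrA.
Qed.

Lemma bar_sigma : bar (t + 2 + t^-1) = t + 2 + t^-1.
Proof.
have bar2 : bar 2 = 2 := rmorph_nat _ 2.
by rewrite rmorphD /= [bar (t + _)]rmorphD /= bar2 -bar_t barK addrC addrA addrAC.
Qed.

Lemma sigma_neq0 : t + 2 + t^-1 <> 0.
Proof.
rewrite sigma_onePt; apply: mul_neq0; last exact/exp_neq0/prime_neq0/onePt_prime.
by apply: unit_neq0; rewrite unitrV t_unit.
Qed.

Lemma non_self_associate_symmetric (p : Lambda) :
  ~ divides p (bar p) -> non_symmetric p.
Proof.
move=> npb u uU up; apply: npb; apply: (divides_unit (bar_unit uU)).
by rewrite -rmorphM /= up; apply/divides_mull/divides_refl.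
Qed.

(** A prime vanishing at -1 is associate to 1 + t, which is associate to its own conjugate. *)
Lemma non_self_associate_leval (p : Lambda) : prime_elt p ->
  ~ divides p (bar p) -> leval p (-1) != 0.
Proof.
move=> p_prime npb; apply/eqP => p1; apply: npb.
have m1 : (-1 : rat) != 0 by rewrite oppr_eq0 oner_eq0.
have := leval_eq0_divides m1 p1; rewrite -onePt => dp.
have [_ onePtU _] := onePt_prime.
have pd := prime_associate p_prime onePtU dp.
apply: (divides_trans pd); apply: (@divides_trans _ (bar (1 + t))).
  by rewrite bar_onePt; apply/divides_mull/divides_refl.
exact: divides_bar.
Qed.


(** * Finite dimension of the module over Q *)

Lemma polyL_coef_wide (n : nat) (r : {poly rat}) : (size r <= n)%N ->
  polyL r = \sum_(j < n) ratL r`_j * t ^+ j.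
Proof.
move=> szr; rewrite -polyLX.
transitivity (polyL (\sum_(j < n) (r`_j)%:P * 'X^j)).
  congr polyL; rewrite -[LHS]coefK poly_def [LHS](big_ord_widen _ (fun j => r`_j *: 'X^j) szr).
  rewrite [LHS]big_mkcond /=; apply: eq_bigr => j _; rewrite mul_polyC.
  by case: ltnP => // /(nth_default 0) ->; rewrite scale0r.
by rewrite rmorph_sum; apply: eq_bigr => j _; rewrite rmorphM rmorphXn.
Qed.

Section FiniteDimension.
Variable A : lmodType Lambda.
Hypotheses (A_fg : finitely_generated A) (A_torsion : torsion A).

(** Each generator is killed by a polynomial with nonzero constant term, so remainders of bounded
    size suffice as coefficients and the products of the generators by small powers of t span. *)
Lemma rat_spanning_family : exists (T : finType) (e : T -> A),
  forall x, exists c : T -> rat, x = \sum_i ratL (c i) *: e i.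
Proof.
have [n [g gP]] := A_fg.
have /fin_all_exists[p pP] (i : 'I_n) : exists p : {poly rat},
    p`_0 != 0 /\ polyL p *: g i = 0.
  have [|||p [_ p0 pg _]] := @Lambda_principal (fun Q => Q *: g i = 0).
  - by move=> P Q Pg Qg; rewrite scalerDl Pg Qg addr0.
  - by move=> P Q Qg; rewrite -scalerA Qg scaler0.
  - by have [P /eqP] := A_torsion (g i); exists P.
  by exists p.
pose d := \max_i size (p i).
exists ('I_n * 'I_d)%type, (fun ij : 'I_n * 'I_d => t ^+ ij.2 *: g ij.1) => x.
have [c ->] := gP x.
have /fin_all_exists[r rP] (i : 'I_n) : exists r : {poly rat},
    (size r < d)%N /\ c i *: g i = polyL r *: g i.
  have [p0 pg] := pP i; have [r szr [a e]] := polyL_remainder (c i) p0.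
  exists r; split; first by apply: leq_trans szr _; apply: leq_bigmax.
  by apply/eqP; rewrite -subr_eq0 -scalerBl e -scalerA pg scaler0.
exists (fun ij : 'I_n * 'I_d => (r ij.1)`_(ij.2)).
rewrite -(pair_bigA _ (fun (i : 'I_n) (j : 'I_d) => ratL (r i)`_j *: (t ^+ j *: g i))) /=.
apply: eq_bigr => i _; have [szr ->] := rP i.
by rewrite (polyL_coef_wide (ltnW szr)) scaler_suml; apply: eq_bigr => j _; rewrite scalerA.
Qed.

(** For [D] the size of a spanning family, the coordinate matrix of [D.+1] vectors has more rows
    than columns, hence a nonzero row in its left kernel. *)
Lemma rat_relation : exists D : nat, forall v : 'I_D.+1 -> A,
  exists2 c : 'I_D.+1 -> rat, (exists i, c i != 0) & \sum_i ratL (c i) *: v i = 0.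
Proof.
have [T [e eP]] := rat_spanning_family; exists #|T| => v.
have /fin_all_exists[c cP] := fun i => eP (v i).
pose C := \matrix_(i < #|T|.+1, j < #|T|) c i (enum_val j).
have : kermx C != 0.
  by rewrite kermx_eq0 /row_free ltn_eqF // ltnS rank_leq_col.
case/rowV0Pn => w /sub_kermxP wC w0; exists (w 0).
  by apply/existsP; rewrite -negb_forall; apply: contra w0 => /forallP w0;
    apply/eqP/rowP => i; rewrite mxE; apply/eqP.
under eq_bigr => i _ do rewrite cP scaler_sumr.
rewrite exchange_big big1 //= => j _.
under eq_bigr => i _ do rewrite scalerA -rmorphM.
rewrite -scaler_suml -rmorph_sum /=.
have -> : \sum_i w 0 i * c i j = (w *m C) 0 (enum_rank j).
  by rewrite mxE; apply: eq_bigr => i _; rewrite mxE enum_rankK.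
by rewrite wC mxE rmorph0 scale0r.
Qed.

(* A Fitting decomposition of y for the action of rho: multiplying y by
   1 + rho S, which is prime to rho, leaves an element killed by rho^m. *)
Lemma coprime_cofactor : exists D : nat, forall (rho : Lambda) (y : A),
  exists m S, (m <= D)%N /\ (rho ^+ m * (1 + rho * S)) *: y = 0.
Proof.
have [D relD] := rat_relation; exists D => rho y.
have [c [i0 ci0] cy] := relD (fun i => rho ^+ i *: y).
(* With [m] the lowest index of a nonzero coefficient, the relation between the powers of [rho] is
   [ratL (c m) * rho ^+ m] times an element congruent to 1 modulo [rho]. *)
case: (@arg_minnP _ i0 (fun i => c i != 0) (@nat_of_ord D.+1) ci0) => m cm mmin.
have [S SE] : divides (rho ^+ m.+1) (\sum_(i : 'I_D.+1 | i != m) ratL (c i) * rho ^+ i).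
  apply: big_ind => [|a b|i im]; [exact: divides0|exact: dividesD|].
  have [ci|ci] := eqVneq (c i) 0; first by rewrite ci rmorph0 mul0r; apply: divides0.
  by apply/divides_mull/divides_exp; rewrite ltn_neqAle eq_sym im mmin.
exists m, (ratL (c m)^-1 * S); split; first by rewrite -ltnS.
have cV : ratL (c m)^-1 * ratL (c m) = 1 by rewrite -rmorphM mulVf ?rmorph1.
have -> : rho ^+ m * (1 + rho * (ratL (c m)^-1 * S)) =
    ratL (c m)^-1 * \sum_(i < D.+1) ratL (c i) * rho ^+ i.
  by rewrite (bigD1 m) //= SE -[in LHS]cV exprS; ring.
rewrite -scalerA scaler_suml.
by under eq_bigr => i _ do rewrite -scalerA; rewrite cy scaler0.
Qed.

End FiniteDimension.


(** * Hermitian forms and orthogonal summands *)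

Section HermitianForms.
Variables (A : lmodType Lambda) (phi : A -> A -> QtL).
Hypothesis phi_herm : hermitian_form phi.
Implicit Types (P Q S T q : Lambda) (x y z g : A) (M : set A).

Lemma hformDl x x' y : phi (x + x') y = phi x y + phi x' y.
Proof. by case: phi_herm. Qed.

Lemma hformDr x y y' : phi x (y + y') = phi x y + phi x y'.
Proof. by case: phi_herm. Qed.

Lemma hformC x y : phi x y = barT (phi y x).
Proof. by case: phi_herm. Qed.

Lemma hformZl P x y : phi (P *: x) y = P *: phi x y.
Proof.
by case: phi_herm => _ _ /(_ P 1 x y) + _; rewrite rmorph1 mulr1 scale1r.
Qed.

Lemma hformZr P x y : phi x (P *: y) = bar P *: phi x y.
Proof. by case: phi_herm => _ _ /(_ 1 P x y) + _; rewrite mul1r scale1r. Qed.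

Lemma hform0l y : phi 0 y = 0.
Proof. by rewrite -(scale0r 0) hformZl scale0r. Qed.

Lemma hform0r x : phi x 0 = 0.
Proof. by rewrite hformC hform0l barT0. Qed.

Lemma hformNl x y : phi (- x) y = - phi x y.
Proof. by rewrite -scaleN1r hformZl scaleN1r. Qed.

Lemma hformBl x x' y : phi (x - x') y = phi x y - phi x' y.
Proof. by rewrite hformDl hformNl. Qed.

Lemma hform_suml (I : Type) (r : seq I) (F : I -> A) y :
  phi (\sum_(i <- r) F i) y = \sum_(i <- r) phi (F i) y.
Proof. exact: (big_morph (phi^~ y) (fun x x' => hformDl x x' y) (hform0l y)). Qed.

Lemma hform_eq0C x y : phi x y = 0 -> phi y x = 0.
Proof. by move=> xy0; rewrite hformC xy0 barT0. Qed.

Lemma hformC_cfrac P q x y : phi x y = cfrac P q -> phi y x = cfrac (bar P) (bar q).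
Proof. by move=> xy; rewrite hformC xy barT_cfrac. Qed.

Lemma hform_cfrac q x y : q <> 0 -> q *: x = 0 -> exists P, phi x y = cfrac P q.
Proof. by move=> q0 qx; apply: cfrac_ex => //; rewrite -hformZl qx hform0l. Qed.

Definition submodule M : Prop :=
  [/\ M 0, forall x y, M x -> M y -> M (x + y) & forall P x, M x -> M (P *: x)].

Definition nondegenerate_on M : Prop :=
  forall x, M x -> (forall y, M y -> phi x y = 0) -> x = 0.

(** Here [m] is an orthogonal projection of [z]: the module is the sum of [M] and its orthogonal. *)
Definition orthogonally_complemented M : Prop :=
  forall z, exists2 m, M m & forall y, M y -> phi (z - m) y = 0.

Definition orthogonal_summand M : Prop :=
  [/\ submodule M, nondegenerate_on M & orthogonally_complemented M].

(** As [S] inverts [P] modulo [q], a multiple of [g] is determined by its pairing with [g]. If [z]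
    pairs with [g] to R / q, its projection is therefore [(R * S) *: g]. *)
Lemma cyclic_summand g P S T q :
    q <> 0 -> bar q = q -> q *: g = 0 -> phi g g = cfrac P q ->
    S * P + T * q = 1 ->
  annihilator_is g q /\ orthogonal_summand (cyclic_submodule g).
Proof.
move=> q0 qsym qg gg ST.
have gQ R : phi (R *: g) g = 0 -> divides q R.
  rewrite hformZl gg scale_cfrac => /(cfrac_eq0 _ q0) qRP.
  have -> : R = S * (R * P) + (R * T) * q.
    by rewrite -[LHS]mulr1 -ST; ring.
  by apply: dividesD; apply: divides_mull => //; apply: divides_refl.
have annq R : divides q R -> R *: g = 0.
  by move=> [a ->]; rewrite -scalerA qg scaler0.
split; first by move=> R; split=> [Rg|]; [apply: gQ; rewrite Rg hform0l|apply: annq].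
split.
- split=> [|_ _ [a _ <-] [b _ <-]|a _ [b _ <-]].
  + by exists 0; rewrite ?scale0r.
  + by exists (a + b); rewrite ?scalerDl.
  + by exists (a * b); rewrite ?scalerA.
- move=> _ [a _ <-] /(_ g) ag; apply/annq/gQ/ag.
  by exists 1; rewrite ?scale1r.
move=> z; have [R zg] : exists R, phi z g = cfrac R q.
  by apply: cfrac_ex => //; rewrite -[q in q *: _]qsym -hformZr qg hform0r.
exists ((R * S) *: g); first by exists (R * S).
move=> _ [a _ <-]; rewrite hformZr hformBl hformZl zg gg scale_cfrac.
rewrite [cfrac R q](_ : _ = cfrac (R * S * P) q) ?subrr ?scaler0 //.
rewrite [in LHS](_ : R = R * S * P + (R * T) * q); last by rewrite -[LHS]mulr1 -ST; ring.
exact: cfrac_addM.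
Qed.

(** Pairing with [g2] reads off the coefficient of [g1] modulo [q], and pairing with [g1] that of
    [g2] modulo [bar q]. This gives the annihilators, the trivial intersection and the
    projection. *)
Lemma hyperbolic_summand g1 g2 q :
    q <> 0 -> q *: g1 = 0 -> bar q *: g2 = 0 -> phi g1 g2 = cfrac 1 q ->
    phi g1 g1 = 0 -> phi g2 g2 = 0 ->
  let M := [set x + y | x in cyclic_submodule g1 & y in cyclic_submodule g2]%classic in
  [/\ annihilator_is g1 q, annihilator_is g2 (bar q),
    (cyclic_submodule g1 `&` cyclic_submodule g2 = [set 0])%classic &
    orthogonal_summand M].
Proof.
move=> q0 qg1 qg2 g12 g11 g22 M.
have bq0 : bar q <> 0 by move/bar_eq0.
have g21 : phi g2 g1 = cfrac 1 (bar q) by rewrite (hformC_cfrac g12) rmorph1.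
have ann1 a : divides q a -> a *: g1 = 0.
  by move=> [b ->]; rewrite -scalerA qg1 scaler0.
have ann2 a : divides (bar q) a -> a *: g2 = 0.
  by move=> [b ->]; rewrite -scalerA qg2 scaler0.
have pair1 a b : phi (a *: g1 + b *: g2) g2 = cfrac a q.
  by rewrite hformDl !hformZl g12 g22 scaler0 addr0 -cfracE.
have pair2 a b : phi (a *: g1 + b *: g2) g1 = cfrac b (bar q).
  by rewrite hformDl !hformZl g11 g21 scaler0 add0r -cfracE.
have M1 : M g1.
  by exists g1; [exists 1; rewrite ?scale1r|exists 0; [exists 0; rewrite ?scale0r|rewrite addr0]].
have M2 : M g2.
  by exists 0; [exists 0; rewrite ?scale0r|exists g2; [exists 1; rewrite ?scale1r|rewrite add0r]].
split.
- move=> a; split=> [ag|]; last exact: ann1.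
  by apply/(cfrac_eq0 _ q0); rewrite -(pair1 a 0) ag scale0r addr0 hform0l.
- move=> a; split=> [ag|]; last exact: ann2.
  by apply/(cfrac_eq0 _ bq0); rewrite -(pair2 0 a) ag scale0r addr0 hform0l.
- apply/seteqP; split=> [_ [[a _ <-] [b _ ba]]|_ ->] /=; last first.
    by split; exists 0; rewrite ?scale0r.
  apply/ann1/(cfrac_eq0 _ q0); rewrite -(pair1 a 0) scale0r addr0 -ba.
  by rewrite hformZl g22 scaler0.
split.
- split.
  + by exists 0; [exists 0; rewrite ?scale0r|exists 0; [exists 0; rewrite ?scale0r|rewrite addr0]].
  + move=> _ _ [_ [a _ <-] [_ [b _ <-] <-]] [_ [a' _ <-] [_ [b' _ <-] <-]].
    exists ((a + a') *: g1); first by exists (a + a').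
    by exists ((b + b') *: g2); [exists (b + b')|rewrite !scalerDl addrACA].
  move=> c _ [_ [a _ <-] [_ [b _ <-] <-]].
  exists ((c * a) *: g1); first by exists (c * a).
  by exists ((c * b) *: g2); [exists (c * b)|rewrite -!scalerA scalerDr].
- move=> _ [_ [a _ <-] [_ [b _ <-] <-]] xM.
  rewrite ann1 ?ann2 ?addr0 //.
    by apply/(cfrac_eq0 _ bq0); rewrite -(pair2 a b) xM.
  by apply/(cfrac_eq0 _ q0); rewrite -(pair1 a b) xM.
move=> z; have [a za] : exists a, phi z g2 = cfrac a q.
  by apply: cfrac_ex => //; rewrite -[q in q *: _]barK -hformZr qg2 hform0r.
have [b zb] : exists b, phi z g1 = cfrac b (bar q).
  by apply: cfrac_ex => //; rewrite -hformZr qg1 hform0r.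
exists (a *: g1 + b *: g2).
  by exists (a *: g1); [exists a|exists (b *: g2); [exists b|]].
move=> _ [_ [c _ <-] [_ [d _ <-] <-]].
by rewrite hformDr !hformZr !hformBl pair1 pair2 za zb !subrr !scaler0 addr0.
Qed.

End HermitianForms.


(** * Halving, and construction of a block inside a nondegenerate submodule [B] *)

Definition half : Lambda := ratL 2^-1.

Lemma half2 : half + half = 1.
Proof. by rewrite -rmorphD /= -[2^-1]mul1r -mulrDl divff ?rmorph1. Qed.

Lemma bar_half : bar half = half.
Proof. exact: bar_ratL. Qed.

Lemma halfD (V : lmodType Lambda) (v : V) : half *: v + half *: v = v.
Proof. by rewrite -scalerDl half2 scale1r. Qed.

Section Summands.
Variables (A : lmodType Lambda) (phi : A -> A -> QtL).
Hypotheses (A_fg : finitely_generated A) (A_torsion : torsion A).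
Hypothesis phi_herm : hermitian_form phi.
Variable B : set A.
Hypotheses (B_sub : submodule B) (B_nondeg : nondegenerate_on phi B).
Implicit Types (a b d p q u v P Q R S T pi : Lambda) (x y z w g : A).

Let BD x y : B x -> B y -> B (x + y). Proof. by case: B_sub => _ + _; apply. Qed.
Let BZ a x : B x -> B (a *: x). Proof. by case: B_sub => _ _; apply. Qed.

Notation hformZl := (hformZl phi_herm).
Notation hformZr := (hformZr phi_herm).
Notation hformDl := (hformDl phi_herm).
Notation hformDr := (hformDr phi_herm).
Notation hformC_cfrac := (hformC_cfrac phi_herm).

(** The exponents are bounded by the [D] of [coprime_cofactor]: on an element killed by a power of
    [p], the cofactor 1 + p S acts injectively, so already [p ^+ k] with k <= D kills it. *)
Lemma exponent_ex p x : B x -> x <> 0 -> p *: x = 0 ->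
  exists n g, [/\ B g, p ^+ n.+1 *: g = 0, p ^+ n *: g <> 0 &
    forall y m, B y -> p ^+ m *: y = 0 -> p ^+ n.+1 *: y = 0].
Proof.
move=> Bx x0 px; have [D cofD] := coprime_cofactor A_fg A_torsion.
have ex : exists n, `[< forall y m, B y -> p ^+ m *: y = 0 -> p ^+ n *: y = 0 >].
  exists D; apply/asboolP => y m _ pm.
  have [k [S [kD]]] := cofD p y; rewrite mulrC -scalerA => pk.
  have {}pk : p ^+ k *: y = 0.
    by apply: (nilpotent_cancel (k := m) pk); rewrite scalerA mulrC -scalerA pm scaler0.
  by rewrite -(subnK kD) exprD -scalerA pk scaler0.
(* The least exponent is not 0, since [x] is nonzero and killed by [p]; the failure of the exponent
   [n] provides [g]. *)
case: (ex_minnP ex) => -[|n] /asboolP nP nmin.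
  by case: x0; rewrite -[x]scale1r -(expr0 p); apply: (nP x 1%N); rewrite ?expr1.
have /asboolPn : ~~ `[< forall y m, B y -> p ^+ m *: y = 0 -> p ^+ n *: y = 0 >].
  by apply/negP => /nmin; rewrite ltnn.
move=> /existsNP[g /existsNP[m /not_implyP[Bg /not_implyP[pm pn]]]].
by exists n, g; split=> //; apply: (nP _ m).
Qed.

(** Nondegeneracy gives [z] with nonzero pairing, and a factor 1 + bar p S makes it primary for
    [bar p]. The pairing stays nonzero because the conjugate factor acts injectively on values
    killed by a power of [p]. *)
Lemma primary_pairing p m w : B w -> w <> 0 -> p ^+ m *: w = 0 ->
  exists z l, [/\ B z, bar p ^+ l *: z = 0 & phi w z <> 0].
Proof.
move=> Bw w0 pw; have [D cofD] := coprime_cofactor A_fg A_torsion.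
have [z [Bz wz]] : exists z, B z /\ phi w z <> 0.
  apply: contrapT => nz; apply: w0; apply: B_nondeg => // y By.
  by apply: contrapT => wy; apply: nz; exists y.
have [l [S [_]]] := cofD (bar p) z; rewrite -scalerA => pz.
exists ((1 + bar p * S) *: z), l; split=> //; first exact: BZ.
rewrite hformZr rmorphD rmorph1 rmorphM /= barK => wz0; apply: wz.
by apply: (nilpotent_cancel (k := m) wz0); rewrite -hformZl pw (hform0l phi_herm).
Qed.

(** An element pairing nontrivially with [p ^+ n *: x] pairs with [x] to a fraction whose numerator
    is prime to [p]; inverting this numerator modulo [p ^+ n.+1] normalises it to 1. *)
Lemma dual_element p n x : prime_elt p -> B x -> p ^+ n.+1 *: x = 0 ->
    p ^+ n *: x <> 0 ->
  exists y m, [/\ B y, bar p ^+ m *: y = 0 & phi x y = cfrac 1 (p ^+ n.+1)].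
Proof.
move=> p_prime Bx px px0.
have p0 := prime_neq0 p_prime; have q0 := @exp_neq0 _ p n.+1 p0.
have [||z [l [Bz pz xz]]] := @primary_pairing p 1 (p ^+ n *: x) _ px0.
- exact: BZ.
- by rewrite expr1 scalerA -exprS.
have [R xzE] := hform_cfrac phi_herm z q0 px.
have npR : ~ divides p R.
  move=> [a RE]; apply: xz; rewrite hformZl xzE scale_cfrac RE.
  by apply/(cfrac_eq0 _ q0); exists a; rewrite exprS; ring.
have [u [v uv]] := bezoutXn n.+1 (prime_bezout p_prime npR).
exists (bar u *: z), l; split; first exact: BZ.
  by rewrite scalerA mulrC -scalerA pz scaler0.
by rewrite hformZr barK xzE scale_cfrac -uv cfrac_addM.
Qed.

Lemma coprime_annihilators p q (c : QtL) : (exists u v, u * p + v * q = 1) ->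
  p *: c = 0 -> q *: c = 0 -> c = 0.
Proof.
by move=> [u [v uv]] pc qc; rewrite -[c]scale1r -uv scalerDl -!scalerA pc qc !scaler0 addr0.
Qed.

Lemma non_self_associate_pair p x : prime_elt p -> ~ divides p (bar p) ->
    B x -> x <> 0 -> p *: x = 0 ->
  exists n g1 g2, [/\ B g1 /\ B g2, p ^+ n.+1 *: g1 = 0, bar (p ^+ n.+1) *: g2 = 0,
    phi g1 g2 = cfrac 1 (p ^+ n.+1) & phi g1 g1 = 0 /\ phi g2 g2 = 0].
Proof.
move=> p_prime npb Bx x0 px.
have [n [g1 [Bg1 pg1 png1 nmax]]] := exponent_ex Bx x0 px.
have [g2 [m [Bg2 pg2 g12]]] := dual_element p_prime Bg1 pg1 png1.
have cop : exists u v, u * bar p ^+ n.+1 + v * p ^+ n.+1 = 1.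
  by apply/bezoutXn/prime_bezout => //; apply: prime_ndivides_exp.
(* Otherwise this element pairs nontrivially with some [z] killed by a power of [p]. Maximality
   gives [p ^+ n.+1 *: z = 0], and moving the scalar to [z] makes the pairing zero. *)
have bpg2 : bar p ^+ n.+1 *: g2 = 0.
  apply: contrapT => w0.
  have [||z [l [Bz]]] := @primary_pairing (bar p) m (bar p ^+ n.+1 *: g2) _ w0.
  - exact: BZ.
  - by rewrite scalerA mulrC -scalerA pg2 scaler0.
  rewrite barK => /nmax-/(_ Bz) pz; apply.
  by rewrite hformZl -[bar p]/(bar p) -rmorphXn -hformZr pz (hform0r phi_herm).
exists n, g1, g2; split=> //; first by rewrite rmorphXn.
split; apply: (coprime_annihilators cop).
- by rewrite -rmorphXn -hformZr pg1 (hform0r phi_herm).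
- by rewrite -hformZl pg1 (hform0l phi_herm).
- by rewrite -hformZl bpg2 (hform0l phi_herm).
by rewrite -[p ^+ _]barK -hformZr rmorphXn bpg2 (hform0r phi_herm).
Qed.

(** Powers of [p] and [bar p] differ by units, so the dual element is also killed by a power of [p],
    and maximality bounds its exponent. *)
Lemma self_associate_pair p u x : prime_elt p -> u \is a GRing.unit -> bar p = u * p ->
    B x -> x <> 0 -> p *: x = 0 ->
  exists n g1 g2, [/\ B g1 /\ B g2, p ^+ n.+1 *: g1 = 0, p ^+ n.+1 *: g2 = 0 &
    phi g1 g2 = cfrac 1 (p ^+ n.+1)].
Proof.
move=> p_prime uU bp Bx x0 px.
have [n [g1 [Bg1 pg1 png1 nmax]]] := exponent_ex Bx x0 px.
have [g2 [m [Bg2 pg2 g12]]] := dual_element p_prime Bg1 pg1 png1.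
exists n, g1, g2; split=> //; apply: (nmax _ m) => //.
rewrite -[LHS]scale1r -(mulVr (unitrX m uU)) -scalerA [u ^+ m *: _]scalerA.
by rewrite -exprMn -bp pg2 scaler0.
Qed.

(** Hensel iteration: [j] is the p-adic precision to which the self-pairing of [x] vanishes. Each
    round raises it until it reaches [n]; then [y] is corrected once. *)
Lemma isotropic_pair p u n x y j : p <> 0 -> u \is a GRing.unit -> bar p = u * p ->
    B x -> B y -> p ^+ n *: x = 0 -> p ^+ n *: y = 0 ->
    phi x y = cfrac 1 (p ^+ n) -> (0 < j)%N ->
    (exists2 a, divides (p ^+ j) a & phi x x = cfrac a (p ^+ n)) ->
  exists g1 g2, [/\ B g1 /\ B g2, p ^+ n *: g1 = 0, p ^+ n *: g2 = 0,
    phi g1 g2 = cfrac 1 (p ^+ n) & phi g1 g1 = 0 /\ phi g2 g2 = 0].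
Proof.
move=> p0 uU bp; have q0 := @exp_neq0 _ p n p0.
have bpX k : divides (p ^+ k) (bar (p ^+ k)).
  by rewrite rmorphXn /= bp exprMn; apply: divides_mull; apply: divides_refl.
have [k] := ubnP (n - j); elim: k => // k IHk in x y j *.
rewrite ltnS => le_k Bx By px py xy j0 [a pja xx].
have [b yy] := hform_cfrac phi_herm y q0 py.
have [nj|jn] := leqP n j.
  have xx0 : phi x x = 0.
    by rewrite xx; apply/(cfrac_eq0 _ q0); apply: divides_trans pja; apply: divides_exp.
  (* With [x] isotropic, the two cross terms each contribute minus half of [phi y y], while
     [phi x y] is unchanged. *)
  exists x, (y + (- half * b) *: x); split=> //.
  - by split=> //; apply: BD; [|apply: BZ].
  - by rewrite scalerDr py scalerA mulrC -scalerA px scaler0 addr0.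
  - by rewrite hformDr hformZr xx0 scaler0 addr0.
  split=> //; rewrite hformDl !hformDr !hformZl !hformZr xx0 !scaler0 addr0.
  have xyb : (- half * b) *: phi x y = - half *: phi y y.
    by rewrite xy yy !scale_cfrac mulr1.
  rewrite xyb (hformC phi_herm y x) -barTZ xyb barTZ -(hformC phi_herm).
  by rewrite rmorphN /= bar_half !scaleNr -addrA -opprD halfD subrr.
(* Newton step: in the self-pairing of [x + l *: y], the cross terms cancel [phi x x] and leave l
   bar(l) b, divisible by p^(2j), hence by p^(j+1) as j > 0. *)
pose l := - half * bar a.
have [c lE] : divides (p ^+ j) l.
  apply: divides_mull; apply: (@divides_trans _ (bar (p ^+ j))); first exact: bpX.
  exact: divides_bar.
(* Since [p] divides [l], the new pairing [1 + l * b] is invertible modulo [p ^+ n]; rescaling [y]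
   by [bar U] restores 1. *)
have [U [V UV]] : exists U V, U * (1 + l * b) + V * p ^+ n = 1.
  apply: bezoutXn; exists 1, (- (c * p ^+ j.-1 * b)).
  by rewrite lE -{1}(prednK j0) exprS; ring.
have x'y : phi (x + l *: y) y = cfrac (1 + l * b) (p ^+ n).
  by rewrite hformDl hformZl xy yy scale_cfrac -cfracD.
have px' : p ^+ n *: (x + l *: y) = 0.
  by rewrite scalerDr px scalerA mulrC -scalerA py scaler0 add0r.
apply: (IHk (x + l *: y) (bar U *: y) j.+1) => //.
- by rewrite subnS; apply: leq_trans le_k; rewrite ltn_predL subn_gt0.
- by apply: BD; [|apply: BZ].
- exact: BZ.
- by rewrite scalerA mulrC -scalerA py scaler0.
- by rewrite hformZr barK x'y scale_cfrac -[in RHS]UV cfrac_addM.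
exists (l * bar l * b).
  apply: divides_mulr; apply: (@divides_trans _ (p ^+ j * p ^+ j)).
    by rewrite -exprD; apply: divides_exp; rewrite -addn1 leq_add2l.
  have [d dE] := bpX j; exists (c * bar c * d).
  by rewrite lE rmorphM /= dE; ring.
rewrite hformDl !hformDr !hformZl !hformZr yy !scale_cfrac.
have xyl : bar l *: phi x y = - half *: phi x x.
  rewrite xy xx !scale_cfrac mulr1; congr cfrac.
  by rewrite rmorphM rmorphN /= bar_half barK.
rewrite xyl (hformC phi_herm y x) -[l in l *: barT _]barK -barTZ xyl barTZ -(hformC phi_herm).
by rewrite rmorphN /= bar_half !scaleNr addrA -[X in X + _]addrA -opprD halfD subrr add0r mulrA.
Qed.

(** If [p] divides the numerators R and R' of the self-pairings of [x] and of the rescaled [y], it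
    cannot divide the numerator R + R' + 2 of that of their sum, because 2 is a unit. *)
Lemma anisotropic_element p q v n x y : prime_elt p -> bar q = q ->
    v \is a GRing.unit -> q = v * p ^+ n.+1 -> B x -> B y ->
    p ^+ n.+1 *: x = 0 -> p ^+ n.+1 *: y = 0 -> phi x y = cfrac 1 (p ^+ n.+1) ->
  exists g P S T, [/\ B g, q *: g = 0, symmetric_elt P, phi g g = cfrac P q &
    S * P + T * q = 1].
Proof.
move=> p_prime qsym vU qE Bx By px py xy.
have p0 := prime_neq0 p_prime; have v0 := unit_neq0 vU.
have q0 : q <> 0 by rewrite qE; apply: mul_neq0 => //; apply: exp_neq0.
have pq : divides p q by exists (v * p ^+ n); rewrite qE exprSr mulrA.
have sym z R : B z -> p ^+ n.+1 *: z = 0 -> phi z z = cfrac R q -> ~ divides p R ->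
    exists g P S T, [/\ B g, q *: g = 0, symmetric_elt P, phi g g = cfrac P q &
      S * P + T * q = 1].
  (* As [phi z z] and [q] equal their conjugates, averaging [R] with its conjugate gives a symmetric
     numerator of the same class. *)
  move=> Bz pz zz npR; pose P := half * (R + bar R).
  have zzP : phi z z = cfrac P q.
    rewrite /P mulrDr cfracD -!scale_cfrac -{2}qsym -barT_cfrac -zz.
    by rewrite -(hformC phi_herm) halfD.
  have npP : ~ divides p P.
    move=> pP; apply: npR; have /(cfrac_eq0 _ q0) qRP : cfrac (R - P) q = 0.
      by rewrite cfracD -mulN1r -scale_cfrac -zzP -zz scaleN1r subrr.
    by rewrite -[R](subrK P); apply: dividesD => //; apply: divides_trans qRP.
  have [S [T ST]] := bezoutXn n.+1 (prime_bezout p_prime npP).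
  exists z, P, S, (T * v^-1); split=> //; first by rewrite qE -scalerA pz scaler0.
    by rewrite /symmetric_elt rmorphM rmorphD /= barK bar_half [bar R + R]addrC.
  by rewrite qE mulrA mulrVK.
have qx : q *: x = 0 by rewrite qE -scalerA px scaler0.
(* This factor changes the denominator of the pairing with [x] from [p ^+ n.+1] to [q]. *)
pose y' := bar v^-1 *: y.
have By' : B y' by apply: BZ.
have py' : p ^+ n.+1 *: y' = 0 by rewrite scalerA mulrC -scalerA py scaler0.
have qy' : q *: y' = 0 by rewrite qE -scalerA py' scaler0.
have xy' : phi x y' = cfrac 1 q.
  by rewrite hformZr barK xy scale_cfrac -(cfracMM _ _ v0) mulrA divrr // mulr1 -qE.
have [R xx] := hform_cfrac phi_herm x q0 qx.
have [R' yy] := hform_cfrac phi_herm y' q0 qy'.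
have [pR|] := pselect (divides p R); last exact: sym xx.
have [pR'|] := pselect (divides p R'); last exact: sym yy.
apply: (sym (x + y') (R + 1 + (1 + R'))).
- exact: BD.
- by rewrite scalerDr px py' addr0.
- rewrite hformDl !hformDr xx yy xy' (hformC phi_herm y') xy' barT_cfrac.
  by rewrite rmorph1 qsym -!cfracD.
move=> p2; have [_ pU _] := p_prime.
suff [b bE] : divides p 1 by case/negP: pU; apply/unitrPr; exists b; rewrite mulrC.
rewrite (_ : 1 = half * (R + 1 + (1 + R') - R - R')); last by rewrite -[LHS]half2; ring.
by apply: divides_mull; apply: dividesB => //; apply: dividesB.
Qed.

(** Hermitian symmetry gives a = t^n bar(a) modulo (1 + t)^n; at t = -1 with [n] odd, the value of
    [a] equals its opposite. This supplies the precision 1 that starts [isotropic_pair]. *)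
Lemma odd_linear_isotropic n x : odd n -> (1 + t) ^+ n *: x = 0 ->
  exists2 a, divides ((1 + t) ^+ 1) a & phi x x = cfrac a ((1 + t) ^+ n).
Proof.
move=> n_odd px; have p0 := prime_neq0 onePt_prime.
have q0 := @exp_neq0 _ (1 + t) n p0.
have [a xx] := hform_cfrac phi_herm x q0 px; exists a; rewrite // expr1.
have : phi x x = cfrac (t ^+ n * bar a) ((1 + t) ^+ n).
  rewrite (hformC_cfrac xx) rmorphXn /= bar_onePt exprMn exprVn.
  rewrite -(cfracMM _ _ (@tX_neq0 n)) mulrA divrr ?mul1r //; exact: tX_unit.
rewrite xx => e; have /(cfrac_eq0 _ q0) : cfrac (a - t ^+ n * bar a) ((1 + t) ^+ n) = 0.
  by rewrite cfracD -mulN1r -scale_cfrac e scaleN1r subrr.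
move/(divides_trans (divides_exp (1 + t) (odd_gt0 n_odd))); rewrite expr1 onePt => da.
have e2 : (-1 : rat) ^+ 2 = 1 by rewrite sqrrN expr1n.
have [r ar] := linear_rat e2 a; have br := linear_divides_bar e2 ar.
have tE := linear_divides_exp (-1) n; rewrite -signr_odd n_odd expr1 in tE.
suff r0 : r = 0 by move: ar; rewrite r0 rmorph0 subr0.
have /(linear_divides_ratL e2)/eqP : divides (t - ratL (-1)) (ratL (2 * r)).
  rewrite (_ : ratL (2 * r) = (a - t ^+ n * bar a) - (a - ratL r)
      + (t ^+ n - ratL (-1)) * bar a - (bar a - ratL r)).
    apply: dividesB => //; apply: dividesD; last exact: divides_mulr.
    exact: dividesB.
  by rewrite rmorphM rmorphN rmorph1 (rmorph_nat ratL 2); ring.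
by rewrite mulf_eq0 => /eqP.
Qed.

(** Take [p] of minimal size killing a nonzero element of [B]. If [p] divides a b and b x is
    nonzero, then [p] generates the annihilator of b x, which contains a. *)
Lemma prime_torsion_element : (exists2 x, B x & x <> 0) ->
  exists (p : {poly rat}) x,
    [/\ p`_0 != 0, prime_elt (polyL p), B x, x <> 0 & polyL p *: x = 0].
Proof.
have ann x : exists p : {poly rat}, [/\ p != 0, p`_0 != 0, polyL p *: x = 0 &
    forall Q, Q *: x = 0 -> divides (polyL p) Q].
  apply: (@Lambda_principal (fun Q => Q *: x = 0)) => [P Q Px Qx|P Q Qx|].
  - by rewrite scalerDl Px Qx addr0.
  - by rewrite -scalerA Qx scaler0.
  by have [P /eqP] := A_torsion x; exists P.
move=> [x0 Bx0 x00].
have ex : exists n, `[< exists (p : {poly rat}) x, [/\ p`_0 != 0, B x, x <> 0,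
    polyL p *: x = 0 & size p = n] >].
  have [p [_ p0 px _]] := ann x0.
  by exists (size p); apply/asboolP; exists p, x0.
case: (ex_minnP ex) => n /asboolP[p [x [p0 Bx xn0 px <-]]] pmin.
have pn0 : p != 0 by apply: contra_neq p0 => ->; rewrite coef0.
(* The annihilator generator of [y] divides [p] and is not smaller, so the two are associate. *)
have annp y Q : B y -> y <> 0 -> polyL p *: y = 0 -> Q *: y = 0 -> divides (polyL p) Q.
  move=> By yn0 py Qy; have [r [rn0 r0 ry r_gen]] := ann y.
  have rp := polyL_divides r0 (r_gen _ py).
  have szr : (size p <= size r)%N by apply: pmin; apply/asboolP; exists r, y.
  have : r %= p by rewrite -(dvdp_size_eqp rp) eqn_leq szr dvdp_leq.
  move=> /andP[_ /dvdpP[s rE]]; apply: divides_trans (r_gen _ Qy).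
  by exists (polyL s); rewrite rE rmorphM.
exists p, x; split=> //; split.
- by rewrite polyL_eq0.
- by apply/negP => pU; apply: xn0; rewrite -[x]scale1r -(mulVr pU) -scalerA px scaler0.
move=> a b pab; have [bx|bx] := pselect (b *: x = 0); first by right; apply: (annp x).
left; apply: (annp (b *: x)) => //; first exact: BZ.
  by rewrite scalerA mulrC -scalerA px scaler0.
by rewrite scalerA; case: pab => c ->; rewrite -scalerA px scaler0.
Qed.

Lemma prime_to_power P S T pi n : (0 < n)%N -> S * P + T * pi ^+ n = 1 ->
  prime_to P pi.
Proof.
move=> n0 ST d dP dpi; suff [c cE] : divides d 1.
  by apply/unitrPr; exists c; rewrite mulrC.
rewrite -ST; apply: dividesD; apply: divides_mull => //.
by rewrite -(prednK n0) exprS; apply: divides_mulr.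
Qed.

Definition block M : Prop :=
  [/\ M `<=` B, orthogonal_summand phi M, exists2 x, M x & x <> 0 &
    kind_i phi M \/ kind_ii phi M]%classic.

Lemma cfrac1_neq0 pi n : (0 < n)%N -> pi \isn't a GRing.unit -> pi ^+ n <> 0 ->
  cfrac 1 (pi ^+ n) <> 0.
Proof.
move=> n0 /negP piU q0 /(cfrac_eq0 _ q0) q1; apply: piU.
have [c cE] : divides pi 1.
  by apply: divides_trans q1; rewrite -(prednK n0) exprS; apply/divides_mulr/divides_refl.
by apply/unitrPr; exists c; rewrite mulrC.
Qed.

Lemma kind_i_block pi n : (0 < n)%N ->
    prime_elt pi /\ symmetric_elt pi \/ pi = t + 2 + t^-1 ->
    pi \isn't a GRing.unit ->
    bar (pi ^+ n) = pi ^+ n -> pi ^+ n <> 0 ->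
  (exists g P S T, [/\ B g, pi ^+ n *: g = 0, symmetric_elt P,
      phi g g = cfrac P (pi ^+ n) & S * P + T * pi ^+ n = 1]) ->
  exists M, block M.
Proof.
move=> n0 pi_cases piU qsym q0 [g [P [S [T [Bg qg Psym gg ST]]]]].
have [annq M_summand] := cyclic_summand phi_herm q0 qsym qg gg ST.
exists (cyclic_submodule g); split=> //.
- by move=> _ [a _ <-]; apply: BZ.
- exists g; first by exists 1; rewrite ?scale1r.
  move=> g0; apply: (cfrac1_neq0 n0 piU q0).
  by rewrite -ST cfrac_addM // -scale_cfrac -gg g0 (hform0l phi_herm) scaler0.
left; exists pi, n, g; split=> //; exists P; split=> //.
exact: prime_to_power ST.
Qed.

Lemma kind_ii_block pi n g1 g2 :
    [/\ prime_elt pi, non_symmetric pi, leval pi (-1) != 0 & (0 < n)%N]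
      \/ [/\ pi = 1 + t, (0 < n)%N & odd n] ->
    prime_elt pi -> B g1 -> B g2 -> pi ^+ n *: g1 = 0 -> bar (pi ^+ n) *: g2 = 0 ->
    phi g1 g2 = cfrac 1 (pi ^+ n) -> phi g1 g1 = 0 -> phi g2 g2 = 0 ->
  exists M, block M.
Proof.
move=> pi_cases pi_prime Bg1 Bg2 qg1 qg2 g12 g11 g22.
have [_ piU _] := pi_prime; have n0 : (0 < n)%N by case: pi_cases => -[].
have q0 := @exp_neq0 _ pi n (prime_neq0 pi_prime).
have [ann1 ann2 dir M_summand] := hyperbolic_summand phi_herm q0 qg1 qg2 g12 g11 g22.
eexists; split; last 1 first.
- by right; exists pi, n, g1, g2; split; rewrite -?rmorphXn.
- by move=> _ [_ [a _ <-] [_ [b _ <-] <-]]; apply: BD; apply: BZ.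
- exact: M_summand.
exists g1.
  by exists g1; [exists 1; rewrite ?scale1r|exists 0; [exists 0; rewrite ?scale0r|rewrite addr0]].
by move=> g10; apply: (cfrac1_neq0 n0 piU q0); rewrite -g12 g10 (hform0l phi_herm).
Qed.

Lemma onePt_block x : B x -> x <> 0 -> (1 + t) *: x = 0 -> exists M, block M.
Proof.
move=> Bx x0 px; have p_prime := onePt_prime; have p0 := prime_neq0 p_prime.
have tVU : t^-1 \is a GRing.unit by rewrite unitrV t_unit.
have [n [g1 [g2 [[Bg1 Bg2] pg1 pg2 g12]]]] :=
  self_associate_pair p_prime tVU bar_onePt Bx x0 px.
case: (boolP (odd n.+1)) => n_odd.
  have [h1 [h2 [[Bh1 Bh2] ph1 ph2 h12 [h11 h22]]]] :=
    isotropic_pair p0 tVU bar_onePt Bg1 Bg2 pg1 pg2 g12 (ltn0Sn 0)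
      (odd_linear_isotropic n_odd pg1).
  apply: (@kind_ii_block (1 + t) n.+1 h1 h2) => //; first by right.
  by rewrite rmorphXn /= bar_onePt exprMn -scalerA ph2 scaler0.
(* For an even exponent 2k, (1 + t)^(2k) is t^k (t + 2 + t^-1)^k: the block is of the first kind
   with exponent k. *)
have nE : n.+1 = (n.+1./2).*2 by rewrite even_halfK.
have k0 : (0 < n.+1./2)%N by rewrite half_gt0; case: (n) n_odd.
have sX : (t + 2 + t^-1) ^+ n.+1./2 = t^-1 ^+ n.+1./2 * (1 + t) ^+ n.+1.
  by rewrite sigma_onePt exprMn -exprM mul2n -nE.
have sbar : bar ((t + 2 + t^-1) ^+ n.+1./2) = (t + 2 + t^-1) ^+ n.+1./2.
  by rewrite rmorphXn /= bar_sigma.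
apply: (kind_i_block k0 _ _ sbar (exp_neq0 sigma_neq0)); first by right.
  by rewrite sigma_onePt unitrM tVU unitrX_pos //; case: p_prime.
exact: (anisotropic_element p_prime sbar (unitrX _ tVU) sX Bg1 Bg2 pg1 pg2 g12).
Qed.

Lemma block_ex : (forall x, (1 - t) *: x = 0 -> x = 0) ->
  (exists2 x, B x & x <> 0) -> exists M, block M.
Proof.
move=> inj1t /prime_torsion_element[p [x [p0 p_prime Bx x0 px]]].
have [pb|npb] := pselect (divides (polyL p) (bar (polyL p))); last first.
  have [n [g1 [g2 [[Bg1 Bg2] pg1 pg2 g12 [g11 g22]]]]] :=
    non_self_associate_pair p_prime npb Bx x0 px.
  apply: (kind_ii_block _ p_prime Bg1 Bg2 pg1 pg2 g12 g11 g22); left; split=> //.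
    exact: non_self_associate_symmetric.
  exact: non_self_associate_leval.
have [[u uU up_sym]|[e e1 ep]] := self_associate_cases p0 pb.
  have up_prime := prime_unitM uU p_prime; have [_ upU _] := up_prime.
  have upx : (u * polyL p) *: x = 0 by rewrite -scalerA px scaler0.
  have upb : bar (u * polyL p) = 1 * (u * polyL p) by rewrite mul1r.
  have [n [g1 [g2 [[Bg1 Bg2] pg1 pg2 g12]]]] :=
    self_associate_pair up_prime (unitr1 _) upb Bx x0 upx.
  have sbar : bar ((u * polyL p) ^+ n.+1) = (u * polyL p) ^+ n.+1.
    by rewrite rmorphXn /= up_sym.
  apply: (kind_i_block (ltn0Sn n) _ upU sbar (exp_neq0 (prime_neq0 up_prime))).
    by left.
  apply: (anisotropic_element up_prime sbar (unitr1 _) _ Bg1 Bg2 pg1 pg2 g12).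
  by rewrite mul1r.
have e2 : e ^+ 2 = 1 by case: e1 => ->; rewrite ?sqrrN expr1n.
have [_ eU _] := linear_prime e2.
(* Here [p] is associate to [t - ratL e], which therefore kills [x]: e = -1 leads to [onePt_block],
   and e = 1 contradicts the injectivity of 1 - t. *)
have [c cE] := prime_associate p_prime eU ep.
have ex : (t - ratL e) *: x = 0 by rewrite cE -scalerA px scaler0.
case: e1 => eE; rewrite {}eE in ex; last first.
  by apply: (onePt_block Bx x0); rewrite onePt.
case: x0; apply: inj1t.
by rewrite -opprB scaleNr -(rmorph1 ratL) ex oppr0.
Qed.

End Summands.


(** * Orthogonal families of blocks and the maximality argument *)

Section OrthogonalFamilies.
Variables (A : lmodType Lambda) (phi : A -> A -> QtL).
Hypothesis phi_herm : hermitian_form phi.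

Lemma orthogonal_family_sum k (M : 'I_k -> set A) (f : 'I_k -> A) j y :
    orthogonal_family phi M -> (forall i, M i (f i)) -> M j y ->
  phi (\sum_i f i) y = phi (f j) y.
Proof.
move=> M_orth fM My; rewrite (hform_suml phi_herm) (bigD1 j) //= big1 ?addr0 //.
by move=> i ij; apply: (M_orth _ _ ij).
Qed.

(** Pairing the sum with a member of the family isolates one term, which nondegeneracy then
    kills. *)
Lemma orthogonal_family_independent k (M : 'I_k -> set A) (f : 'I_k -> A) :
    orthogonal_family phi M -> (forall i, nondegenerate_on phi (M i)) ->
    (forall i, M i (f i)) -> \sum_i f i = 0 ->
  forall i, f i = 0.
Proof.
move=> M_orth M_nondeg fM f0 i; apply: M_nondeg (fM i) _ => y My.
by rewrite -(orthogonal_family_sum M_orth fM My) f0 (hform0l phi_herm).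
Qed.

Definition block_family k (M : 'I_k -> set A) : Prop :=
  orthogonal_family phi M /\ forall i, block phi setT (M i).

Hypotheses (A_fg : finitely_generated A) (A_torsion : torsion A).

(** Nonzero vectors chosen in [D.+1] distinct members would satisfy a rational relation, whose terms
    all vanish by independence. *)
Lemma block_family_bound : exists D : nat,
  forall k (M : 'I_k -> set A), block_family M -> (k <= D)%N.
Proof.
have [D relD] := rat_relation A_fg A_torsion; exists D => k M [M_orth M_block].
rewrite leqNgt; apply/negP => Dk; pose w := widen_ord Dk.
have /fin_all_exists[x xP] (i : 'I_D.+1) : exists x, M (w i) x /\ x <> 0.
  by case: (M_block (w i)) => _ _ [x] *; exists x.
have [c [i ci] cx] := relD x; have [_ xi0] := xP i; apply: xi0.
have cxi : ratL (c i) *: x i = 0.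
  apply: (@orthogonal_family_independent _ (M \o w) (fun i => ratL (c i) *: x i)) => //.
  - move=> a b ab; apply: M_orth; apply: contra_neq ab => /(congr1 val) ab.
    exact: val_inj.
  - by move=> a; case: (M_block (w a)) => _ [].
  move=> a; have [_ [[_ _ MZ] _ _] _ _] := M_block (w a).
  by apply: MZ; case: (xP a).
by rewrite -[x i]scale1r -(mulVr (ratL_unit ci)) -scalerA cxi scaler0.
Qed.

Definition orthogonal_complement k (M : 'I_k -> set A) : set A :=
  [set x | forall i y, M i y -> phi x y = 0]%classic.

Lemma orthogonal_complement_submodule k (M : 'I_k -> set A) :
  submodule (orthogonal_complement M).
Proof.
split=> [i y _|x x' xM x'M i y My|P x xM i y My].
- exact: hform0l.
- by rewrite (hformDl phi_herm) (xM i) ?(x'M i) ?addr0.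
- by rewrite (hformZl phi_herm) (xM i) ?scaler0.
Qed.

Lemma orthogonal_complement_decomposition k (M : 'I_k -> set A) : block_family M ->
  forall z, exists f : {ffun 'I_k -> A},
    (forall i, M i (f i)) /\ orthogonal_complement M (z - \sum_i f i).
Proof.
move=> [M_orth M_block] z.
have /fin_all_exists[f fP] (i : 'I_k) : exists m,
    M i m /\ forall y, M i y -> phi (z - m) y = 0.
  by have [_ [_ _ /(_ z)[m Mm zm]] _ _] := M_block i; exists m.
have fM i : M i (finfun f i) by rewrite ffunE; case: (fP i).
exists (finfun f); split=> // j y My.
rewrite (hformBl phi_herm) (orthogonal_family_sum M_orth fM My) ffunE.
by rewrite -(hformBl phi_herm); apply: (fP j).2.
Qed.

(** Any [z] is a sum of elements of the family plus an element of the complement, and [x] is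
    orthogonal to both parts. *)
Lemma orthogonal_complement_nondegenerate k (M : 'I_k -> set A) :
    non_degenerate phi -> block_family M ->
  nondegenerate_on phi (orthogonal_complement M).
Proof.
move=> phi_nondeg MF x xM x0; apply: phi_nondeg => z.
have [f [fM zf]] := orthogonal_complement_decomposition MF z.
rewrite -[z](subrK (\sum_i f i)) (hformDr phi_herm) x0 // add0r.
apply: (hform_eq0C phi_herm); rewrite (hform_suml phi_herm) big1 // => i _.
by apply: (hform_eq0C phi_herm); apply: xM.
Qed.

(** The new member takes index 0 and the old ones move up by one; orthogonality across holds because
    [N] lies in the complement. *)
Lemma block_family_extend k (M : 'I_k -> set A) (N : set A) :
    block_family M -> block phi (orthogonal_complement M) N ->
  block_family (fun i : 'I_k.+1 => oapp M N (unlift ord0 i)).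
Proof.
move=> [M_orth M_block] [NM N_summand N_neq0 N_kind]; split=> [i j|i].
  case: (unliftP ord0 i) => [i' ->|->]; case: (unliftP ord0 j) => [j' ->|->] //=.
  - by rewrite (inj_eq lift_inj) => ij; apply: M_orth.
  - by move=> _ x y Mx Ny; apply: (hform_eq0C phi_herm); apply: NM Mx.
  by move=> _ x y Nx My; apply: NM My.
by case: (unliftP ord0 i) => [i' _|_] /=; [apply: M_block|].
Qed.

End OrthogonalFamilies.

Theorem theorem1p3 (A : lmodType Lambda) (phi : A -> A -> QtL)
    (A_fg : finitely_generated A) (A_torsion : torsion A)
    (A_bij : bijective (fun x : A => (1 - t) *: x))
    (phi_herm : hermitian_form phi) (phi_nondeg : non_degenerate phi) :
  exists (k : nat) (M : 'I_k -> set A),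
    [/\ is_direct_sum M, orthogonal_family phi M &
        forall i, kind_i phi (M i) \/ kind_ii phi (M i)].
Proof.
have [D boundD] := block_family_bound phi_herm A_fg A_torsion.
pose P k := `[< exists M : 'I_k -> set A, block_family phi M >].
have exP : exists k, P k.
  by exists 0; apply/asboolP; exists (fun _ => set0); split; case.
have leP k : P k -> (k <= D)%N by move=> /asboolP[M]; apply: boundD.
case: (ex_maxnP exP leP) => k /asboolP[M MF] kmax; exists k, M.
have [M_orth M_block] := MF.
have M_nondeg i : nondegenerate_on phi (M i) by case: (M_block i) => _ [].
split=> // [x|i]; last by case: (M_block i).
(* A nonzero element of the complement would yield one more block, against the maximality of [k]. *)
have compl0 y : orthogonal_complement phi M y -> y = 0.
  move=> yM; apply: contrapT => y0.
  have inj1t (z : A) : (1 - t) *: z = 0 -> z = 0.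
    by have /= := @bij_inj _ _ _ A_bij z 0; rewrite scaler0.
  have [|N N_block] := @block_ex A phi A_fg A_torsion phi_herm _
    (orthogonal_complement_submodule phi_herm M)
    (orthogonal_complement_nondegenerate phi_herm phi_nondeg MF) inj1t.
    by exists y.
  have /kmax : P k.+1.
    by apply/asboolP; eexists; apply: block_family_extend N_block.
  by rewrite ltnn.
have [f [fM /compl0/eqP]] := orthogonal_complement_decomposition phi_herm MF x.
rewrite subr_eq0 => /eqP xf; exists f; split=> // g [gM xg].
apply/ffunP => i; apply/eqP; rewrite -subr_eq0; apply/eqP.
(* Uniqueness: the differences of two decompositions lie in the members and sum to zero. *)
apply: (@orthogonal_family_independent _ _ phi_herm k M (fun i => f i - g i)) => //.
  move=> j; have [_ [[_ MD MZ] _ _] _ _] := M_block j.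
  by apply: MD; [exact: fM|rewrite -scaleN1r; apply: MZ].
by rewrite sumrB -xf -xg subrr.
Qed.
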